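(* Suppose the following Growth Assumption holds: there are constants $\mu>0$, $d\ge1$ and $0<\Delta\le1$ such that for every $x\in\mathcal B\setminus X_\Omega$, $$P\{\omega\in\Omega : f_\omega(x)\ge \mu\,\mathrm{dist}(x,X_\Omega)^d\}\ \ge\ \Delta .$$ Let $0<\epsilon<M\,\mathrm{dist}(x_0,X_\Omega)$ and $0<\Gamma<\Delta$, let $L\ge1$ be an integer, and set $p=1-(1-\Gamma)^L$ and $$\mathbb{E}' = \frac4p\left(1+\left(\frac{M}{\mu^{1/d}\epsilon^{1-1/d}}\right)^2\min\left\{\frac{1}{4^{1-1/d}-1},\ \log_2\left(\frac{M\,\mathrm{dist}(x_0,X_\Omega)}{\epsilon}\right)\right\}\right),$$ where for $d=1$ the quantity $\frac{1}{4^{1-1/d}-1}$ is interpreted as $+\infty$. Run the algorithm PolyakFM with inputs $x_0$ and $L$, and let $x_0,x_1,x_2,\dots$ be its (random) iterates. Then PolyakFM reaches an iterate $x_k$ satisfying both $P(\Omega(x_k,\epsilon))\ge1-\Gamma$ and $\mathrm{dist}(x_k,X_\Omega)\le(\epsilon/\mu)^{1/d}$ within an expected number of iterations not exceeding $\mathbb{E}'$; that is, the expected value of the smallest $k\ge0$ for which $x_k$ satisfies both of these conditions is at most $\mathbb{E}'$. Moreover, for every integer $k\ge2\mathbb{E}'$, $$\mathrm{Prob}\big(x_k \text{ is the first iterate satisfying } P(\Omega(x_k,\epsilon))\ge 1-\Gamma\big)\ \le\ \frac12\left(\frac{1}{1+\frac12\frac{p}{1-p}}\right)^{k-\lceil 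2\mathbb{E}'\rceil}.$$
   Context: Setting. $(\Omega,\mathcal F,P)$ is a probability space ($\Omega$ may be finite or infinite). For each $\omega\in\Omega$, $f_\omega:\mathbb{R}^n\to\mathbb{R}$ is a convex function. $\|\cdot\|$ is the Euclidean norm. All sets and maps whose probabilities or expectations are taken are understood to be measurable. Define $X_\Omega=\{x : f_\omega(x)\le 0 \text{ for all } \omega\in\Omega\}$, assumed nonempty, and let $\mathrm{dist}(x,X_\Omega)$ denote the Euclidean distance from $x$ to $X_\Omega$. For a point $x$ and a scalar $\epsilon>0$ let $\Omega(x,\epsilon)=\{\omega\in\Omega : f_\omega(x)\le\epsilon\}$. Fix an initial point $x_0$; let $z_0$ be the point of $X_\Omega$ closest to $x_0$, and let $\mathcal B=\{x:\|x-z_0\|\le\|x_0-z_0\|\}$. It is assumed that, for every $\omega$, $f_\omega$ is $M$-Lipschitz (i.e. $|f_\omega(x)-f_\omega(y)|\le M\|x-y\|$) on an open neighborhood of $\mathcal B$. For each $\omega$ and $x$, $g_\omega(x)$ denotes a fixed element of the subdifferential $\partial f_\omega(x)$ (a fixed subgradient selection). Algorithm PolyakFM (input: $x_0$ and an integer $L\ge1$, the minibatch size). For $k=1,2,3,\dots$: (1) Independently draw samples $\omega_{k,1},\dots,\omega_{k,L}$ from $(\Omega,\mathcal F,P)$ (with replacement, and independently of all earlier samples). (2) Let $\ell_k$ be an index maximizing $f_{\omega_{k,\ell}}(x_{k-1})$ over $\ell=1,\dots,L$ (ties broken by a fixed rule) and let $\epsilon_{k-1}=f_{\omega_{k,\ell_k}}(x_{k-1})$.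 If $\epsilon_{k-1}\le 0$, set $x_k=x_{k-1}$; otherwise set $x_k=x_{k-1}-\frac{\epsilon_{k-1}}{\|g\|^2}\,g$ where $g=g_{\omega_{k,\ell_k}}(x_{k-1})$. $\mathrm{Prob}$ and expected values refer to the random draws of all the samples. *)

(* Defs.v *)
From HB Require Import structures.
From mathcomp Require Import all_boot all_order all_algebra.
From mathcomp Require Import all_classical all_reals all_analysis.

Set Implicit Arguments.
Unset Strict Implicit.
Unset Printing Implicit Defensive.

Import Order.TTheory GRing.Theory Num.Theory.
Import numFieldNormedType.Exports.

Local Open Scope classical_set_scope.
Local Open Scope ring_scope.

(* The library norm on 'rV[R]_n is the sup norm, hence [enorm].  Both norms
   induce the same topology, so [open] below is the usual notion. *)
Definition dotv (R : realType) (n : nat) (u v : 'rV[R]_n) : R :=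
  \sum_(i < n) u 0 i * v 0 i.

Definition enorm (R : realType) (n : nat) (u : 'rV[R]_n) : R :=
  Num.sqrt (\sum_(i < n) u 0 i ^+ 2).

Definition edistance (R : realType) (n : nat) (x : 'rV[R]_n)
    (X : set 'rV[R]_n) : R :=
  inf [set enorm (x - y) | y in X].

Definition eball (R : realType) (n : nat) (z : 'rV[R]_n) (r : R) :
    set 'rV[R]_n :=
  [set x | enorm (x - z) <= r].

Definition is_closest (R : realType) (n : nat) (x : 'rV[R]_n)
    (X : set 'rV[R]_n) (z : 'rV[R]_n) : Prop :=
  X z /\ forall y, X y -> enorm (x - z) <= enorm (x - y).

Definition elipschitz_on (R : realType) (n : nat) (M : R)
    (U : set 'rV[R]_n) (h : 'rV[R]_n -> R) : Prop :=
  forall x y, U x -> U y -> `|h x - h y| <= M * enorm (x - y).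

Definition subdifferential (R : realType) (n : nat) (h : 'rV[R]_n -> R)
    (x : 'rV[R]_n) : set 'rV[R]_n :=
  [set g | forall y, h x + dotv g (y - x) <= h y].

Definition feasible_set (R : realType) (n : nat) (Omega : Type)
    (f : Omega -> 'rV[R]_n -> R) : set 'rV[R]_n :=
  [set x | forall w, f w x <= 0].

Definition near_satisfied (R : realType) (n : nat) (Omega : Type)
    (f : Omega -> 'rV[R]_n -> R) (x : 'rV[R]_n) (eps : R) : set Omega :=
  [set w | f w x <= eps].

Definition growth_assumption (R : realType) (n : nat) (d : measure_display)
    (Omega : measurableType d) (P : probability Omega R)
    (f : Omega -> 'rV[R]_n -> R) (B : set 'rV[R]_n) (mu a Delta : R) : Prop :=
  forall x, B x -> ~ feasible_set f x ->
    (Delta%:E <= P [set w | (mu * edistance x (feasible_set f) `^ a <= f w x)%R])%E.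

(* [sel x s] is an index of the minibatch [s] maximizing [f (s l) x]; how ties
   are broken is arbitrary. *)
Definition argmax_rule (R : realType) (n : nat) (Omega : Type) (L : nat)
    (f : Omega -> 'rV[R]_n -> R)
    (sel : 'rV[R]_n -> ('I_L -> Omega) -> 'I_L) : Prop :=
  forall x s l, f (s l) x <= f (s (sel x s)) x.

Definition polyak_step (R : realType) (n : nat) (Omega : Type) (L : nat)
    (f : Omega -> 'rV[R]_n -> R) (g : Omega -> 'rV[R]_n -> 'rV[R]_n)
    (sel : 'rV[R]_n -> ('I_L -> Omega) -> 'I_L)
    (s : 'I_L -> Omega) (x : 'rV[R]_n) : 'rV[R]_n :=
  let w := s (sel x s) in
  if f w x <= 0 then x
  else x - (f w x / enorm (g w x) ^+ 2) *: g w x.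

(* The minibatch drawn to compute x_(k+1) from x_k is [s k]. *)
Fixpoint polyakFM (R : realType) (n : nat) (Omega : Type) (L : nat)
    (f : Omega -> 'rV[R]_n -> R) (g : Omega -> 'rV[R]_n -> 'rV[R]_n)
    (sel : 'rV[R]_n -> ('I_L -> Omega) -> 'I_L)
    (x0 : 'rV[R]_n) (s : nat -> 'I_L -> Omega) (k : nat) : 'rV[R]_n :=
  if k is j.+1 then polyak_step f g sel (s j) (polyakFM f g sel x0 s j)
  else x0.

Definition mutually_independent (R : realType) (d d' : measure_display)
    (T : measurableType d) (Omega : measurableType d') (Q : probability T R)
    (I : eqType) (W : I -> T -> Omega) : Prop :=
  forall (J : seq I) (A : I -> set Omega),
    uniq J -> (forall i, i \in J -> measurable (A i)) ->
    Q (\bigcap_(i in [set` J]) (W i @^-1` A i)) =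
    (\prod_(i <- J) Q (W i @^-1` A i))%E.

Definition iid_samples (R : realType) (d d' : measure_display)
    (T : measurableType d) (Omega : measurableType d') (Q : probability T R)
    (P : probability Omega R) (L : nat)
    (W : nat -> 'I_L -> {RV Q >-> Omega}) : Prop :=
  (forall k l A, measurable A -> distribution Q (W k l) A = P A) /\
  mutually_independent Q (fun i : nat * 'I_L => W i.1 i.2 : T -> Omega).

(* The sigma-algebra generated by the samples of the first k rounds. *)
Definition sample_history (R : realType) (d d' : measure_display)
    (T : measurableType d) (Omega : measurableType d') (Q : probability T R)
    (L : nat) (W : nat -> 'I_L -> {RV Q >-> Omega}) (k : nat) : set (set T) :=
  <<s [set C | exists i l A,
        [/\ (i < k)%N, measurable A & C = W i l @^-1` A]] >>.

(* Borel measurability of x_0, x_1, x_2 ... as functions of the samples drawn: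
   the preimage of every open set lies in [sample_history]. *)
Definition measurable_iterates (R : realType) (n : nat)
    (d d' : measure_display) (T : measurableType d)
    (Omega : measurableType d') (Q : probability T R) (L : nat)
    (W : nat -> 'I_L -> {RV Q >-> Omega}) (x : nat -> T -> 'rV[R]_n) : Prop :=
  forall k (U : set 'rV[R]_n), open U -> sample_history W k (x k @^-1` U).

Definition is_first (V : Type) (good : set V) (x : nat -> V) (k : nat) : Prop :=
  good (x k) /\ forall j, (j < k)%N -> ~ good (x j).

(* The smallest k with [good (x k)], and +oo if there is none. *)
Definition first_time (R : realType) (V : Type) (good : set V) (x : nat -> V) :
    \bar R :=
  ereal_inf [set (k%:R)%:E | k in [set k | good (x k)]].

Definition log2 (R : realType) (y : R) : R := ln y / ln 2.

Definition batch_prob (R : realType) (Gamma : R) (L : nat) : R :=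
  1 - (1 - Gamma) ^+ L.

(* min {1 / (4^(1 - 1/a) - 1), log2 y}, the first term being +oo for a = 1. *)
Definition growth_min (R : realType) (a y : R) : R :=
  if a == 1 then log2 y
  else Num.min (1 / (4 `^ (1 - 1 / a) - 1)) (log2 y).

(* The bound E' on the expected number of iterations; [D] is the distance from
   x_0 to the feasible set and [a] the growth exponent. *)
Definition iteration_bound (R : realType) (M mu a eps p D : R) : R :=
  4 / p * (1 + (M / (mu `^ (1 / a) * eps `^ (1 - 1 / a))) ^+ 2
               * growth_min a (M * D / eps)).

(* Main.v *)
Require Import Defs.
From HB Require Import structures.
From mathcomp Require Import all_boot all_order all_algebra.
From mathcomp Require Import all_classical all_reals all_analysis.
From mathcomp Require Import measurable_realfun ring lra.

Set Implicit Arguments.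
Unset Strict Implicit.
Unset Printing Implicit Defensive.

Import Order.TTheory GRing.Theory Num.Theory.
Import numFieldNormedType.Exports.

Local Open Scope classical_set_scope.
Local Open Scope ring_scope.

(** A step with violation [0 < c], the value at the iterate of the most violated
    sampled constraint, lowers the squared distance to the feasible set by at
    least [(c / M) ^+ 2] ([edistance_step_descent]), and no step moves away from a
    feasible point, so all iterates stay in the ball.

    Call an iterate done when it is both good and close. At an iterate that is not
    done, each sample violates its constraint by at least the growth level, the
    maximum of [eps] and [mu] times the distance to the power [a], with
    probability at least [Gamma]: by the growth assumption if the iterate is far,
    and because it is not good if it is close ([not_done_success_prob]). Hence a
    round succeeds, given the past, with probability at least [p]
    ([success_event]).

    The number of successes before being done is bounded along every trajectory
    ([successes_lt]). Two potentials of the distance give the two terms of the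
    minimum in [E']: the logarithm, as each success contracts the distance
    geometrically, and, for [1 < a], the antiderivative of the inverse of the
    squared growth level, which is bounded. The constants leave room for
    counting as a success a violation by only 9/10 of the growth level. This is
    what allows the random iterate to be replaced by a nearby deterministic
    point when independence of the new samples is used.

    The number of successes in [k] rounds thus dominates a binomial variable, and
    the probability of not being done at time [k] is at most that of collecting
    at most [n] successes in [k] trials, where [n + 1 <= p * E']
    ([running_not_done_le]). Summing over [k] bounds the expectation by
    [(n + 1) / p]. For the tail, Markov's inequality gives 1/2 at the time
    [2 * E'], after which the lower tail of the binomial distribution decays at
    the stated geometric rate ([bin_cdf_decay]). *)

(** * Euclidean geometry in coordinates *)

Section euclid.
Context (R : realType) (n : nat).
Implicit Types u v w x y z : 'rV[R]_n.

Lemma dotvC u v : dotv u v = dotv v u.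
Proof. by apply: eq_bigr => i _; rewrite mulrC. Qed.

Lemma dotvDl u v w : dotv (u + v) w = dotv u w + dotv v w.
Proof. by rewrite -big_split; apply: eq_bigr => i _; rewrite mxE mulrDl. Qed.

Lemma dotvZl (c : R) u v : dotv (c *: u) v = c * dotv u v.
Proof. by rewrite [RHS]mulr_sumr; apply: eq_bigr => i _; rewrite mxE mulrA. Qed.

Lemma dotvDr u v w : dotv u (v + w) = dotv u v + dotv u w.
Proof. by rewrite dotvC dotvDl !(dotvC u). Qed.

Lemma dotvZr (c : R) u v : dotv u (c *: v) = c * dotv u v.
Proof. by rewrite dotvC dotvZl dotvC. Qed.

Lemma dotvNr u v : dotv u (- v) = - dotv u v.
Proof. by rewrite -scaleN1r dotvZr mulN1r. Qed.

Lemma dotvNl u v : dotv (- u) v = - dotv u v.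
Proof. by rewrite dotvC dotvNr dotvC. Qed.

Lemma enorm_ge0 u : 0 <= enorm u.
Proof. exact: sqrtr_ge0. Qed.

Lemma sqr_enorm u : enorm u ^+ 2 = dotv u u.
Proof.
rewrite sqr_sqrtr; last by apply: sumr_ge0 => i _; exact: sqr_ge0.
by apply: eq_bigr => i _; rewrite expr2.
Qed.

Lemma enormN u : enorm (- u) = enorm u.
Proof. by congr Num.sqrt; apply: eq_bigr => i _; rewrite mxE sqrrN. Qed.

Lemma enorm_distC u v : enorm (u - v) = enorm (v - u).
Proof. by rewrite -enormN opprB. Qed.

(** Cauchy-Schwarz: the squared norm of [dotv v v *: u - dotv u v *: v] is
    nonnegative. *)
Lemma dotv_le u v : dotv u v <= enorm u * enorm v.
Proof.
apply: le_trans (ler_norm _) _.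
rewrite -(ler_pXn2r (_ : 0 < 2)%N) ?nnegrE ?mulr_ge0 ?enorm_ge0//.
rewrite exprMn !sqr_enorm real_normK ?num_real//.
set p := dotv u u; set q := dotv v v; set b := dotv u v.
have q0 : 0 <= q by rewrite /q -sqr_enorm sqr_ge0.
have : 0 <= dotv (q *: u - b *: v) (q *: u - b *: v) by rewrite -sqr_enorm sqr_ge0.
rewrite !(dotvDl, dotvDr, dotvZl, dotvZr, dotvNl, dotvNr) -/p -/q (dotvC v) -/b => H.
have {}H : 0 <= q * (p * q - b ^+ 2) by move: H; nra.
have [q_gt0|] := ltP 0 q; first by rewrite -subr_ge0 -(pmulr_rge0 _ q_gt0).
move=> qle0.
have qE : q = 0 by apply/eqP; rewrite eq_le qle0.
have vi i : v 0 i = 0.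
  have : dotv v v == 0 by apply/eqP.
  rewrite /dotv psumr_eq0; last by move=> j _; rewrite -expr2 sqr_ge0.
  by move=> /allP/(_ i (mem_index_enum _)); rewrite /= mulf_eq0 orbb => /eqP.
by rewrite /b /dotv big1 ?expr0n ?qE ?mulr0// => i _; rewrite vi mulr0.
Qed.

Lemma ler_enormD u v : enorm (u + v) <= enorm u + enorm v.
Proof.
rewrite -(ler_pXn2r (_ : 0 < 2)%N) ?nnegrE ?addr_ge0 ?enorm_ge0//.
rewrite sqr_enorm dotvDl !dotvDr (dotvC v) sqrrD !sqr_enorm.
by have := dotv_le u v; lra.
Qed.

Lemma ler_enorm_dist x y z : enorm (x - z) <= enorm (x - y) + enorm (y - z).
Proof. by apply: le_trans (ler_enormD _ _); rewrite addrA subrK. Qed.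

Lemma enorm_eq0 u : (enorm u == 0) = (u == 0).
Proof.
apply/eqP/eqP => [u0|->]; last first.
  by rewrite /enorm big1 ?sqrtr0// => i _; rewrite mxE expr0n.
have : dotv u u == 0 by rewrite -sqr_enorm u0 expr0n.
rewrite /dotv psumr_eq0; last by move=> j _; rewrite -expr2 sqr_ge0.
move=> /allP ui; apply/rowP => i; rewrite mxE.
by have := ui i (mem_index_enum _); rewrite /= mulf_eq0 orbb => /eqP.
Qed.

Lemma enorm_gt0 u : (0 < enorm u) = (u != 0).
Proof. by rewrite lt_neqAle enorm_ge0 andbT eq_sym enorm_eq0. Qed.

Lemma continuous_enormB y : continuous (fun x : 'rV[R]_n => enorm (x - y)).
Proof.
move=> x; apply: (@continuous_comp _ _ _
  (fun x : 'rV[R]_n => \sum_(i < n) (x - y) 0 i ^+ 2) Num.sqrt); last exact: sqrt_continuous.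
apply: (@continuous_big _ _ +%R 0 xpredT _ _ _ (fun i x => (x - y) 0 i ^+ 2)) => [|i _ {}x].
  exact: add_continuous.
have xi : (fun z : 'rV[R]_n => (z - y) 0 i) @ x --> (x - y) 0 i.
  rewrite (_ : (fun z : 'rV[R]_n => (z - y) 0 i) = fun z => z 0 i - y 0 i).
    rewrite !mxE.
    have c1 : (fun z : 'rV[R]_n => z 0 i) @ x --> x 0 i by exact: coord_continuous.
    exact: (@cvgB _ R^o _ _ _ _ _ _ _ c1 (cvg_cst _)).
  by apply/funext => z; rewrite !mxE.
rewrite /continuous_at (_ : (fun z : 'rV[R]_n => _ ^+ 2) =
  fun z => (z - y) 0 i * (z - y) 0 i); last by apply/funext => z; rewrite expr2.
rewrite expr2; exact: (cvgM xi xi).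
Qed.

Lemma near_enorm x (e : R) : 0 < e -> \forall y \near x, enorm (y - x) < e.
Proof.
move=> e0; have := @continuous_enormB x x.
rewrite /continuous_at/= => /cvgr_lt/(_ e); apply.
by rewrite subrr (eqP (_ : enorm 0 == 0)) ?enorm_eq0.
Qed.

(** The sup norm is at most the Euclidean one, hence a closed Euclidean ball is
    bounded for the norm of the topology. *)
Lemma eball_compact z (r : R) : compact (eball z r).
Proof.
apply: bounded_closed_compact.
  exists (enorm z + r); split; first exact: num_real.
  move=> M /ltW Mr x; rewrite /eball/= => xr.
  have xb : enorm x <= M.
    apply: le_trans Mr; rewrite addrC.
    by apply: le_trans (lerD xr (lexx _)); rewrite -{1}(subrK z x) ler_enormD.
  rewrite [leLHS]/Num.norm/= mx_normrE; apply: bigmax_le; first exact: le_trans (enorm_ge0 _) xb.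
  move=> [i j] _ /=; rewrite (ord1 i); apply: le_trans xb.
  rewrite -sqrtr_sqr ler_wsqrtr// (bigD1 j)//= lerDl sumr_ge0// => k _; exact: sqr_ge0.
have -> : eball z r = (fun x => enorm (x - z)) @^-1` [set t | t <= r] by [].
by apply: closed_comp; [move=> x _; exact: continuous_enormB|exact: closed_le].
Qed.

End euclid.

(** * Distance to a set, and subgradients *)

Section distance.
Context (R : realType) (n : nat) (X : set 'rV[R]_n).
Implicit Types x y z : 'rV[R]_n.

Lemma edistance_le y z : X z -> edistance y X <= enorm (y - z).
Proof.
move=> Xz; apply: ge_inf; last by exists z.
by exists 0 => _ [w _ <-]; exact: enorm_ge0.
Qed.

Lemma le_edistance y (c : R) : X !=set0 ->
  (forall z, X z -> c <= enorm (y - z)) -> c <= edistance y X.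
Proof.
move=> [z Xz] H; apply: lb_le_inf; first by exists (enorm (y - z)), z.
by move=> _ [w Xw <-]; exact: H.
Qed.

Lemma edistance_ge0 y : X !=set0 -> 0 <= edistance y X.
Proof. by move=> X0; apply: le_edistance => // z _; exact: enorm_ge0. Qed.

Lemma edistance_lip x y : X !=set0 ->
  edistance x X <= edistance y X + enorm (x - y).
Proof.
move=> X0; rewrite -lerBlDr; apply: le_edistance => // z Xz.
rewrite lerBlDr addrC; apply: le_trans (ler_enorm_dist _ y _).
exact: edistance_le.
Qed.

Lemma continuous_edistance : X !=set0 -> continuous (fun x => edistance x X).
Proof.
move=> X0 x; apply/(@cvgrPdist_lt _ R^o _ _ (nbhs_filter x)) => e e0.
near=> y; have xy : enorm (y - x) < e by near: y; exact: near_enorm.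
have := edistance_lip x y X0; have := edistance_lip y x X0.
by rewrite ltr_norml (enorm_distC x y) => H1 H2; apply/andP; split; lra.
Unshelve. all: by end_near. Qed.

(** The subgradient inequality at a point [z] with [h z <= 0] reads
    [h x <= dotv v (x - z)]. So, after expanding the square, the cross term is
    at least twice the second order term. *)
Lemma polyak_descent (h : 'rV[R]_n -> R) v x z :
  subdifferential h x v -> 0 < h x -> h z <= 0 ->
  0 < enorm v /\
  enorm (x - (h x / enorm v ^+ 2) *: v - z) ^+ 2 <=
    enorm (x - z) ^+ 2 - h x ^+ 2 / enorm v ^+ 2.
Proof.
move=> /(_ z) hv hx hz.
have vxz : h x <= dotv v (x - z).
  by move: hv; rewrite -opprB dotvNr; lra.
have v0 : 0 < enorm v.
  rewrite enorm_gt0; apply/eqP => v0; move: vxz.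
  by rewrite v0 /dotv big1 ?leNgt ?hx// => i _; rewrite mxE mul0r.
split=> //; set c := h x / _.
have -> : x - c *: v - z = (x - z) + (- c) *: v.
  by rewrite scaleNr addrAC.
move: (x - z) vxz => u vxz.
rewrite !sqr_enorm dotvDl !dotvDr !dotvZl !dotvZr (dotvC u v) -!sqr_enorm.
have c0 : 0 <= c by rewrite ltW // divr_gt0 ?exprn_gt0.
have cE : c * enorm v ^+ 2 = h x by rewrite /c divfK// sqrf_eq0 gt_eqF.
have -> : h x ^+ 2 / enorm v ^+ 2 = c * h x by rewrite /c expr2 mulrAC.
have c2E : c * (c * enorm v ^+ 2) = c * h x by rewrite cE.
by have := ler_wpM2l c0 vxz; lra.
Qed.

(** Along the short segment from [x] to [x + t *: v], [h] grows by at least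
    [t * enorm v ^+ 2] (subgradient) and at most [M * (t * enorm v)]. *)
Lemma subgradient_enorm_le (M : R) (U : set 'rV[R]_n) h x v : 0 <= M ->
  open U -> U x -> elipschitz_on M U h -> subdifferential h x v -> enorm v <= M.
Proof.
move=> M0 oU Ux hL hv; have [v0|v0] := eqVneq v 0.
  by rewrite (eqP (_ : enorm v == 0))// enorm_eq0 v0.
have v_gt0 : 0 < enorm v by rewrite enorm_gt0.
have : \forall t \near (0 : R)^'+, U (x + t *: v).
  have : (fun t : R => x + t *: v) t @[t --> (0 : R)^'+] --> x + (0 : R) *: v.
    apply: cvg_at_right_filter; apply: cvgD; first exact: cvg_cst.
    by apply: cvgZr_tmp; exact: cvg_id.
  by rewrite scale0r addr0; apply; exact: open_nbhs_nbhs.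
move=> nU; have [t [Ut t0]] : exists t : R, U (x + t *: v) /\ 0 < t.
  have : \forall t \near (0 : R)^'+, U (x + t *: v) /\ 0 < t.
    by near=> t; split; near: t => //; exact: nbhs_right_gt.
  by move=> /filter_ex[t ?]; exists t.
have xtv : x + t *: v - x = t *: v by rewrite addrC addKr.
have := hL _ _ Ut Ux; rewrite xtv => /(le_trans (ler_norm _)).
have := hv (x + t *: v); rewrite xtv dotvZr -sqr_enorm.
have -> : enorm (t *: v) = t * enorm v.
  apply/eqP; rewrite -(eqrXn2 (_ : 0 < 2)%N) ?mulr_ge0 ?enorm_ge0 ?(ltW t0)//.
  by rewrite exprMn !sqr_enorm dotvZl dotvZr mulrA expr2.
move=> H1 H2; have {H1 H2} : t * enorm v ^+ 2 <= M * (t * enorm v) by lra.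
by rewrite [M * _]mulrCA ler_pM2l// expr2 ler_pM2r.
Unshelve. all: by end_near. Qed.

End distance.

(** * One step of the algorithm *)

Section step.
Context (R : realType) (n : nat) (Omega : Type) (L : nat).
Context (f : Omega -> 'rV[R]_n -> R) (g : Omega -> 'rV[R]_n -> 'rV[R]_n).
Context (sel : 'rV[R]_n -> ('I_L -> Omega) -> 'I_L).
Hypothesis g_subgrad : forall w x, subdifferential (f w) x (g w x).
Hypothesis sel_argmax : argmax_rule f sel.
Let X := feasible_set f.
Let step s x := polyak_step f g sel s x.

(** Fejer monotonicity: it confines the iterates to the ball on which the
    constraints are Lipschitz. *)
Lemma polyak_step_fejer s x z : X z -> enorm (step s x - z) <= enorm (x - z).
Proof.
move=> Xz; rewrite /step /polyak_step; case: ifPn => //; rewrite -ltNge => fx.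
rewrite -(ler_pXn2r (_ : 0 < 2)%N) ?nnegrE ?enorm_ge0//.
have [g0 /le_trans] := polyak_descent (g_subgrad _ _) fx (Xz _); apply.
by rewrite gerBl divr_ge0// sqr_ge0.
Qed.

Lemma polyak_step_descent (M c : R) s x l z : 0 < M ->
  (forall w, enorm (g w x) <= M) -> 0 < c -> c <= f (s l) x -> X z ->
  enorm (step s x - z) ^+ 2 <= enorm (x - z) ^+ 2 - (c / M) ^+ 2.
Proof.
move=> M0 gM c0 cf Xz; rewrite /step /polyak_step; set w := s (sel x s).
have cfw : c <= f w x := le_trans cf (sel_argmax _ _ _).
have fw0 : 0 < f w x := lt_le_trans c0 cfw.
rewrite (lt_geF fw0).
have [g0 /le_trans] := polyak_descent (g_subgrad w x) fw0 (Xz _); apply.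
rewrite lerB// -expr_div_n lerXn2r// ?nnegrE; try by rewrite ltW// divr_gt0.
by apply: ler_pM; rewrite ?invr_ge0 ?lef_pV2 ?posrE//; exact: ltW.
Qed.

Lemma edistance_step_fejer s x : X !=set0 ->
  edistance (step s x) X <= edistance x X.
Proof.
move=> X0; apply: le_edistance => // z Xz; apply: le_trans (polyak_step_fejer s x Xz).
exact: edistance_le.
Qed.

(** The decrease is the same for every feasible [z], so it passes to the infimum
    defining the distance. *)
Lemma edistance_step_descent (M c : R) s x l : X !=set0 -> 0 < M ->
  (forall w, enorm (g w x) <= M) -> 0 < c -> c <= f (s l) x ->
  edistance (step s x) X ^+ 2 <= edistance x X ^+ 2 - (c / M) ^+ 2.
Proof.
move=> X0 M0 gM c0 cf; rewrite lerBrDr.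
set d' := edistance _ X; have d'0 : 0 <= d' by exact: edistance_ge0.
have e0 : 0 <= d' ^+ 2 + (c / M) ^+ 2 by rewrite addr_ge0 ?sqr_ge0.
rewrite -(sqr_sqrtr e0) ler_pXn2r ?nnegrE ?sqrtr_ge0 ?edistance_ge0//.
apply: le_edistance => // z Xz.
rewrite -(ger0_norm (enorm_ge0 (x - z))) -sqrtr_sqr ler_wsqrtr//.
rewrite -lerBrDr; apply: le_trans (polyak_step_descent M0 gM c0 cf Xz).
by rewrite ler_pXn2r ?nnegrE ?enorm_ge0// edistance_le.
Qed.

Lemma polyakFM_eball x0 z0 s k : X z0 ->
  eball z0 (enorm (x0 - z0)) (polyakFM f g sel x0 s k).
Proof.
move=> Xz; rewrite /eball/=; elim: k => [//|k IH] /=.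
exact: le_trans (polyak_step_fejer _ _ _) IH.
Qed.

(** The bound goes through the subgradient at [x], because the feasible points
    may lie outside the ball on which [f w] is Lipschitz. *)
Lemma constraint_le_edistance (M : R) w x : X !=set0 -> 0 < M ->
  enorm (g w x) <= M -> f w x <= M * edistance x X.
Proof.
move=> X0 M0 gM; rewrite mulrC -ler_pdivrMr//; apply: le_edistance => // z Xz.
rewrite ler_pdivrMr// mulrC.
have := g_subgrad w x z; rewrite -opprB dotvNr; have := Xz w.
have := dotv_le (g w x) (x - z); have := ler_wpM2r (enorm_ge0 (x - z)) gM.
lra.
Qed.

End step.

(** * Counting the successful steps of a trajectory *)

Section counting.
Context {R : realType}.

(** For [delta = (eps / mu) `^ (1 / a)] and [0 <= r] this is the maximum of [eps]
    and [mu * r `^ a]. Keeping the base of the power at least 1 makes it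
    continuous in [r] everywhere, whereas [r `^ a] is [1] for all negative [r]. *)
Definition growth_level (eps delta a r : R) : R :=
  eps * Num.max 1 (r / delta) `^ a.

Lemma powR_ge1 (x a : R) : 1 <= x -> 0 <= a -> 1 <= x `^ a.
Proof. by move=> x1 a0; rewrite -(powRr0 x) ler_powR. Qed.

Lemma growth_level_ge_eps (eps delta a r : R) : 0 < eps -> 1 <= a ->
  eps <= growth_level eps delta a r.
Proof.
move=> e0 a1; rewrite /growth_level ler_peMr ?(ltW e0)//.
by rewrite powR_ge1 ?le_max ?lexx// (le_trans ler01).
Qed.

Lemma potential_count (H d : nat -> R) (b : nat -> bool) (c : R) k :
  (forall i, (i < k)%N -> H i.+1 <= H i - c *+ b i) ->
  c * (\sum_(i < k) b i)%N%:R <= H 0%N - H k.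
Proof.
elim: k => [_|k IH Hk]; first by rewrite big_ord0 mulr0 subrr.
rewrite big_ord_recr/= natrD mulrDr mulr_natr.
have := IH (fun i ik => Hk i (ltnW ik)); have := Hk k (ltnSn k).
by rewrite mulr_natr; lra.
Qed.

(** Convexity of the exponential: the chord of [s |-> 4 `^ s] over [0, 1]. *)
Lemma powR4_le (s : R) : 0 <= s -> s <= 1 -> 4 `^ s - 1 <= 3 * s.
Proof.
move=> s0 s1; have l4 : (4 : R) != 0 by rewrite pnatr_eq0.
rewrite /powR (negbTE l4); set m := s * ln 4.
have e4 : expR (ln 4) = 4 :> R by apply: lnK; rewrite posrE.
(* Average this tangent inequality at [ln 4] and [0] with weights [s] and
   [1 - s]: the linear terms cancel because [m] is the mean of the two points. *)
have tangent y : expR m * (1 + (y - m)) <= expR y.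
  by rewrite -[in leRHS](subrKC m y) expRD ler_wpM2l ?expR_ge0// expR_ge1Dx.
have := ler_wpM2l s0 (tangent (ln 4)); rewrite e4.
have /ler_wpM2l/(_ _ _ (tangent 0)) : 0 <= 1 - s by rewrite subr_ge0.
rewrite expR0 /m; set x := expR _; set l := ln 4; lra.
Qed.

(** The antiderivative of [v |-> 1 / max 1 v `^ a] that vanishes at [0]. A
    success lowers the normalized squared distance [v] by at least a fixed
    multiple of [max 1 v `^ a], hence, by concavity, lowers this potential by a constant; and
    the potential is bounded, which makes the bound independent of the starting
    point when [1 < a]. *)
Definition growth_potential (a v : R) : R :=
  if v <= 1 then v else 1 + (1 - v `^ (1 - a)) / (a - 1).

(** With [t = v' / v] this is the Bernoulli inequality
    [1 + (a - 1) * (1 - t) <= t `^ (1 - a)], obtained from [ln t <= t - 1]. *)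
Lemma growth_potential_tangent_gt1 (a v v' : R) : 1 < a -> 1 <= v' -> v' <= v ->
  (v - v') / v `^ a <= (v' `^ (1 - a) - v `^ (1 - a)) / (a - 1).
Proof.
move=> a1 v'1 v'v; have a10 : 0 < a - 1 by rewrite subr_gt0.
have v'0 : 0 < v' by exact: lt_le_trans v'1.
have v0 : 0 < v by exact: lt_le_trans v'v.
rewrite ler_pdivlMr//; pose t := v' / v.
have t0 : 0 < t by rewrite divr_gt0.
have v'E : v' = v * t by rewrite /t mulrCA divff ?mulr1// gt_eqF.
have tE : 1 + (a - 1) * (1 - t) <= t `^ (1 - a).
  have lt1 : ln t <= t - 1.
    by rewrite -{1}(subrKC 1 t) le_ln1Dx//; lra.
  rewrite /powR gt_eqF//; apply: le_trans (expR_ge1Dx _).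
  by have := ler_wpM2l (ltW a10) lt1; lra.
have vE : v / v `^ a = v `^ (1 - a) by rewrite powRB ?powRr1 ?(ltW v0)// (gt_eqF v0) implybT.
have -> : v' `^ (1 - a) = v `^ (1 - a) * t `^ (1 - a).
  by rewrite -powRM ?ltW// -v'E.
have -> : (v - v') / v `^ a * (a - 1) = v `^ (1 - a) * ((a - 1) * (1 - t)).
  by rewrite -vE v'E; ring.
by have := ler_wpM2l (powR_ge0 v (1 - a)) tE; lra.
Qed.

Lemma growth_potential_tangent (a v v' : R) : 1 < a -> 0 <= v' -> v' <= v ->
  growth_potential a v' <= growth_potential a v - (v - v') / Num.max 1 v `^ a.
Proof.
move=> a1 v'0 v'v; rewrite /growth_potential.
have [v1|v1] := leP v 1.
  by rewrite (le_trans v'v v1) powR1; lra.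
have [v'1|v'1] := leP v' 1; last first.
  have := growth_potential_tangent_gt1 a1 (ltW v'1) v'v.
  by rewrite !mulrBl; lra.
have := growth_potential_tangent_gt1 a1 (lexx 1) (ltW v1); rewrite powR1.
have : (1 - v') / v `^ a <= 1 - v'.
  rewrite ler_pdivrMr ?powR_gt0 ?(lt_trans ltr01)// ler_peMr ?subr_ge0//.
  by rewrite powR_ge1// ltW// (lt_trans ltr01).
by rewrite !mulrBl; lra.
Qed.

Lemma growth_potential_ge0 (a v : R) : 1 < a -> 0 <= v -> 0 <= growth_potential a v.
Proof.
move=> a1 v0; rewrite /growth_potential; case: (leP v 1) => // v1.
rewrite addr_ge0 ?ler01// divr_ge0 ?subr_ge0 ?(ltW a1)//.
have /(ler_powR (ltW v1)) : 1 - a <= 0 by rewrite subr_le0 ltW.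
by rewrite powRr0.
Qed.

Lemma growth_potential_le (a v : R) : 1 < a -> growth_potential a v <= a / (a - 1).
Proof.
move=> a1; have a10 : 0 < a - 1 by rewrite subr_gt0.
have -> : a / (a - 1) = 1 + 1 / (a - 1).
  by field; rewrite gt_eqF.
rewrite /growth_potential; case: (leP v 1) => [v1|v1].
  by rewrite (le_trans v1)// lerDl divr_ge0 ?ler01// ltW.
by rewrite lerD2l ler_pM2r ?invr_gt0// gerBl powR_ge0.
Qed.

Section trajectory.
Variables (eps delta a M : R) (d : nat -> R) (b : nat -> bool) (k : nat).
Hypotheses (eps0 : 0 < eps) (delta0 : 0 < delta) (M0 : 0 < M) (a1 : 1 <= a).
Hypothesis d0 : forall i, 0 <= d i.
Hypothesis d_mono : forall i, (i < k)%N -> d i.+1 <= d i.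
Hypothesis d_succ : forall i, (i < k)%N -> b i ->
  d i.+1 ^+ 2 <= d i ^+ 2 - (9 / 10 * growth_level eps delta a (d i) / M) ^+ 2.
Let C := (M * delta / eps) ^+ 2.

Let C0 : 0 < C.
Proof. by rewrite exprn_gt0// divr_gt0// mulr_gt0. Qed.

Let d_ge i : (i <= k)%N -> d k <= d i.
Proof.
move=> ik; rewrite -(subnKC ik).
have : (i + (k - i) <= k)%N by rewrite subnKC.
elim: (k - i)%N => [|j IH]; first by rewrite addn0.
by rewrite addnS => jk; apply: le_trans (d_mono jk) (IH (ltnW jk)).
Qed.

(** As [eps * (r / delta) <= growth_level eps delta a r], a success multiplies the
    squared distance by at most [1 - 81 / 100 / C]; it can only be repeated until
    the distance falls from [d 0] to [eps / M]. *)
Lemma success_count_log : eps <= M * d k ->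
  (\sum_(i < k) b i)%N%:R <= 4 * C * log2 (M * d 0%N / eps).
Proof.
move=> dk; have dk0 : 0 < d k.
  by rewrite -(pmulr_rgt0 _ M0) (lt_le_trans eps0).
have di0 i : (i <= k)%N -> 0 < d i by move=> /d_ge; exact: lt_le_trans.
pose c := 81 / 100 / C.
have /potential_count : forall i, (i < k)%N ->
    ln (d i.+1 ^+ 2) <= ln (d i ^+ 2) - c *+ b i.
  move=> i ik; have := d_succ ik; case: (b i) => [/(_ isT) H|_]; last first.
    rewrite mulr0n subr0 ler_ln ?posrE ?exprn_gt0 ?di0//; last exact: ltnW.
    by rewrite lerXn2r ?nnegrE ?d_mono.
  have {}H : d i.+1 ^+ 2 <= d i ^+ 2 * (1 - c).
    apply: le_trans H _; rewrite mulrBr mulr1 lerD2l lerN2.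
    have -> : d i ^+ 2 * c = (9 / 10 * (eps * (d i / delta)) / M) ^+ 2.
      by rewrite /c /C; field; rewrite !gt_eqF.
    rewrite lerXn2r ?nnegrE//.
    - by rewrite !mulr_ge0 ?invr_ge0 ?ler0n ?(ltW eps0) ?(ltW delta0) ?(ltW M0).
    - by rewrite !mulr_ge0 ?invr_ge0 ?ler0n ?powR_ge0 ?(ltW eps0) ?(ltW M0).
    rewrite ler_pM2r ?invr_gt0// ler_pM2l// ler_pM2l//.
    apply: (@le_trans _ _ (Num.max 1 (d i / delta))); first by rewrite le_max lexx orbT.
    by rewrite le1r_powR// le_max lexx.
  have c1 : 0 < 1 - c.
    have := lt_le_trans (exprn_gt0 2 (di0 _ ik)) H.
    by rewrite pmulr_rgt0// exprn_gt0// di0// ltnW.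
  rewrite mulr1n; apply: (@le_trans _ _ (ln (d i ^+ 2 * (1 - c)))).
    by rewrite ler_ln ?posrE ?mulr_gt0 ?exprn_gt0 ?di0// ltnW.
  rewrite lnM ?posrE ?exprn_gt0 ?di0//; last exact: ltnW.
  by rewrite lerD2l le_ln1Dx// ltrNr; lra.
rewrite !lnXn ?di0// -mulrnBl => /(_ d).
have d0k : d 0%N / d k <= M * d 0%N / eps.
  rewrite ler_pdivrMr// (_ : M * d 0%N / eps * d k = d 0%N * (M * d k / eps)).
    by rewrite ler_peMr// ler_pdivlMr// mul1r.
  by ring.
have {d0k} : ln (d 0%N) - ln (d k) <= ln (M * d 0%N / eps).
  rewrite -ln_div ?posrE ?di0// ler_ln ?posrE ?divr_gt0 ?mulr_gt0 ?di0//.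
set l := ln (M * _ / _); set S := _%:R => ldk HS.
have ln2 : 0 < ln 2 :> R by rewrite ln_gt0 ?ltr1n.
have ln2_le : ln 2 <= 1 :> R.
  by have := @le_ln1Dx R 1; apply; lra.
have l0 : 0 <= l.
  apply: le_trans ldk; rewrite subr_ge0 ler_ln ?posrE ?di0//; exact: d_ge.
have HS' : S <= 200 / 81 * C * l.
  have : c * S <= 2 * l by move: HS; rewrite mulr2n; lra.
  rewrite /c -ler_pdivlMl; last by rewrite divr_gt0.
  move=> /le_trans; apply; rewrite invf_div.
  by have := mulr_ge0 (ltW C0) l0; lra.
have l_le : l <= l / ln 2 by rewrite ler_peMr// invf_ge1.
apply: le_trans HS' _; rewrite /log2 -/l; move: (l / ln 2) l_le => q l_le.
by have := ler_wpM2l (ltW C0) l_le; have := mulr_ge0 (ltW C0) l0; lra.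
Qed.

(** The same count with the potential [growth_potential], bounded by
    [1 / (1 - 1 / a)]. The comparison with [4 / (4 `^ s - 1)], where
    [s = 1 - 1 / a], uses [4 `^ s - 1 <= 3 * s] and the inequality
    [3 / 4 <= (9 / 10) ^+ 2]. *)
Lemma success_count_growth : 1 < a ->
  (\sum_(i < k) b i)%N%:R <= 4 * C * (1 / (4 `^ (1 - 1 / a) - 1)).
Proof.
move=> a_gt1; have a_gt0 : 0 < a by exact: lt_trans a_gt1.
have a10 : 0 < a - 1 by rewrite subr_gt0.
pose v i := (d i / delta) ^+ 2; pose c := 81 / 100 / C.
have v0 i : 0 <= v i by exact: sqr_ge0.
have /potential_count : forall i, (i < k)%N ->
    growth_potential a (v i.+1) <= growth_potential a (v i) - c *+ b i.
  move=> i ik; have vv : v i.+1 <= v i.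
    by rewrite /v lerXn2r ?nnegrE ?divr_ge0 ?(ltW delta0)// ler_pM2r ?invr_gt0 ?d_mono.
  have m0 : 0 < Num.max 1 (v i) `^ a by rewrite powR_gt0// lt_max ltr01.
  apply: le_trans (growth_potential_tangent a_gt1 (v0 _) vv) _.
  rewrite lerD2l lerN2; have := d_succ ik; case: (b i); last first.
    by rewrite mulr0n divr_ge0 ?subr_ge0// ltW.
  move=> /(_ isT) H; rewrite mulr1n ler_pdivlMr//.
  have -> : Num.max 1 (v i) `^ a = (Num.max 1 (d i / delta) `^ a) ^+ 2.
    have u0 : 0 <= d i / delta by rewrite divr_ge0// ltW.
    have m1 : 0 <= Num.max 1 (d i / delta) by rewrite le_max ler01.
    rewrite expr2 -powRM//; congr (_ `^ _).
    rewrite -expr2 /v; case: (leP 1 (d i / delta)) => u1.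
      by apply/max_idPr; rewrite expr_ge1.
    by rewrite expr1n; apply/max_idPl; rewrite expr_le1// ltW.
  move: H; rewrite /growth_level; set m := _ `^ a.
  have -> : c * m ^+ 2 = (9 / 10 * (eps * m) / M) ^+ 2 / delta ^+ 2.
    by rewrite /c /C; field; rewrite !gt_eqF.
  rewrite /v !expr_div_n -mulrBl ler_pM2r ?invr_gt0 ?exprn_gt0//.
  lra.
move=> /(_ v); set S := _%:R => HS.
have {}HS : c * S <= a / (a - 1).
  apply: le_trans HS _; rewrite lerBlDr ler_wpDr ?growth_potential_ge0//.
  exact: growth_potential_le.
have s_ge0 : 0 <= 1 - 1 / a by rewrite subr_ge0 ler_pdivrMr// mul1r.
have := @powR4_le (1 - 1 / a) s_ge0; rewrite gerBl divr_ge0 ?(ltW a_gt0)// => /(_ isT).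
have : 0 < 4 `^ (1 - 1 / a) - 1 :> R.
  rewrite subr_gt0 /powR pnatr_eq0/= expR_gt1 mulr_gt0 ?ln_gt0 ?ltr1n//.
  by rewrite subr_gt0 ltr_pdivrMr// mul1r.
set q := 4 `^ _ - 1 => q0 q3.
rewrite mul1r ler_pdivlMr//.
have s0 : 0 < 1 - 1 / a by rewrite subr_gt0 ltr_pdivrMr// mul1r.
have S0 : 0 <= S by exact: ler0n.
apply: (@le_trans _ _ (S * (3 * (1 - 1 / a)))); first by rewrite ler_wpM2l.
have {}HS : S <= 100 / 81 * C * (a / (a - 1)).
  have -> : S = 100 / 81 * C * (c * S) by rewrite /c; field; rewrite gt_eqF.
  by rewrite ler_wpM2l// mulr_ge0// ltW.
apply: (@le_trans _ _ (100 / 81 * C * (a / (a - 1)) * (3 * (1 - 1 / a)))).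
  by rewrite ler_pM2r// mulr_gt0.
have -> : 100 / 81 * C * (a / (a - 1)) * (3 * (1 - 1 / a)) = 300 / 81 * C.
  by field; rewrite !gt_eqF.
by rewrite ler_pM2r//; lra.
Qed.

End trajectory.
End counting.

(** * Lower tails of the binomial distribution *)

Section binomial_tail.
Context {R : realType} (p : R).
Hypotheses (p0 : 0 < p) (p1 : p < 1).

Definition bin_pmf (k j : nat) : R := 'C(k, j)%:R * p ^+ j * (1 - p) ^+ (k - j).

(** The probability of at most [n] successes in [k] independent trials. *)
Definition bin_cdf (k n : nat) : R := \sum_(j < n.+1) bin_pmf k j.

Let q0 : 0 < 1 - p. Proof. by rewrite subr_gt0. Qed.

Lemma bin_pmf_ge0 k j : 0 <= bin_pmf k j.
Proof. by rewrite !mulr_ge0 ?ler0n ?exprn_ge0 ?ltW. Qed.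

Lemma bin_cdf_ge0 k n : 0 <= bin_cdf k n.
Proof. by apply: sumr_ge0 => j _; exact: bin_pmf_ge0. Qed.

Lemma bin_cdfS k n : bin_cdf k n.+1 = bin_cdf k n + bin_pmf k n.+1.
Proof. by rewrite /bin_cdf big_ord_recr. Qed.

Lemma bin_pmf_rec k j :
  bin_pmf k.+1 j.+1 = p * bin_pmf k j + (1 - p) * bin_pmf k j.+1.
Proof.
rewrite /bin_pmf binS natrD subSS exprS; case: (ltnP j k) => jk.
  by rewrite -(subnSK jk) exprS; ring.
by rewrite (bin_small (_ : k < j.+1)%N)//; ring.
Qed.

Lemma bin_cdf_step k n : bin_cdf k.+1 n = bin_cdf k n - p * bin_pmf k n.
Proof.
elim: n => [|n IH]; last by rewrite !bin_cdfS IH bin_pmf_rec; ring.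
by rewrite /bin_cdf !big_ord1 /bin_pmf !bin0 !subn0 exprS; ring.
Qed.

Lemma bin_cdf_rec k n :
  bin_cdf k.+1 n.+1 = p * bin_cdf k n + (1 - p) * bin_cdf k n.+1.
Proof. by rewrite bin_cdf_step bin_cdfS; ring. Qed.

Lemma bin_cdf_rec0 k : bin_cdf k.+1 0 = (1 - p) * bin_cdf k 0.
Proof. by rewrite bin_cdf_step /bin_cdf big_ord1; ring. Qed.

Lemma bin_cdf0 n : bin_cdf 0 n = 1.
Proof.
elim: n => [|n IH]; last by rewrite bin_cdfS IH /bin_pmf bin0n/=; ring.
by rewrite /bin_cdf big_ord1 /bin_pmf bin0 subnn !expr0; ring.
Qed.

Lemma bin_cdf_antitone n k k' : (k <= k')%N -> bin_cdf k' n <= bin_cdf k n.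
Proof.
move=> kk; rewrite -(subnKC kk); elim: (k' - k)%N => [|i IH]; first by rewrite addn0.
rewrite addnS bin_cdf_step; apply: le_trans IH.
by rewrite gerBl mulr_ge0 ?bin_pmf_ge0 ?ltW.
Qed.

(** The sum over all [k] is the mean number of trials needed to collect [n + 1]
    successes. *)
Lemma sum_bin_cdf_le K n : p * (\sum_(k < K) bin_cdf k n) <= n.+1%:R.
Proof.
have rec (u : nat -> R) N : u 0%N = 1 -> (forall k, 0 <= u k) ->
    \sum_(k < N) u k <= 1 + \sum_(k < N) u k.+1.
  move=> u0 uge0; case: N => [|N]; first by rewrite !big_ord0 addr0 ler01.
  rewrite big_ord_recl u0 big_ord_recr/= lerD2l lerDl//.
elim: n => [|n IH].
  have := rec (bin_cdf ^~ 0%N) K (bin_cdf0 _) (bin_cdf_ge0 ^~ _).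
  under [in X in 1 + X]eq_bigr do rewrite bin_cdf_rec0.
  by rewrite -mulr_sumr; lra.
have := rec (bin_cdf ^~ n.+1) K (bin_cdf0 _) (bin_cdf_ge0 ^~ _).
under [in X in 1 + X]eq_bigr do rewrite bin_cdf_rec.
by rewrite big_split/= -!mulr_sumr -(natr1 n.+1); lra.
Qed.

Lemma bin_pmf_ratio k j : (j < k)%N ->
  j.+1%:R * (1 - p) * bin_pmf k j.+1 = (k - j)%:R * p * bin_pmf k j.
Proof.
move=> jk; have /(congr1 (fun i => i%:R : R)) := mul_bin_left k j; rewrite !natrM => H.
rewrite /bin_pmf exprS -(subnSK jk) exprS (subnSK jk).
transitivity (j.+1%:R * 'C(k, j.+1)%:R * (p * p ^+ j * (1 - p) * (1 - p) ^+ (k - j.+1))).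
  by ring.
by rewrite H; ring.
Qed.

(** When the mean number of successes in [k + 1] trials is at least [2 * (n + 1)],
    the ratio of consecutive weights [bin_pmf k j / bin_pmf k j.+1], for [j < n], is at most
    [(1 - p) / (2 - p)]; the lower tail is then bounded by a geometric series with
    sum [2 - p]. *)
Lemma bin_cdf_le_pmf k n : 2 * n.+1%:R <= p * k.+1%:R ->
  bin_cdf k n <= (2 - p) * bin_pmf k n.
Proof.
elim: n => [_|n IH kn].
  rewrite /bin_cdf big_ord1 ler_peMl ?bin_pmf_ge0//; move: p1; lra.
have nk : (n < k)%N.
  rewrite -(ltr_nat R) -(ltrD2r 1) !natr1.
  apply: (@lt_le_trans _ _ (2 * n.+2%:R)).
    by rewrite -natrM ltr_nat mul2n -addnn ltn_addr.
  by apply: le_trans kn _; rewrite ler_piMl// ltW.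
have {}IH := IH _.
rewrite bin_cdfS.
have h1 : bin_cdf k n <= (2 - p) * bin_pmf k n.
  by apply: IH; apply: le_trans kn; rewrite ler_pM2l// ler_nat.
suff h2 : (2 - p) * bin_pmf k n <= (1 - p) * bin_pmf k n.+1.
  by apply: le_trans (lerD (le_trans h1 h2) (lexx _)) _; lra.
rewrite -(ler_pM2l (ltr0Sn R n)) [leRHS]mulrA bin_pmf_ratio// mulrA.
rewrite ler_wpM2r ?bin_pmf_ge0// natrB ?(ltnW nk)//.
by move: kn; rewrite -!natr1; lra.
Qed.

Lemma bin_cdf_decay k n : 2 * n.+1%:R <= p * k.+1%:R ->
  bin_cdf k.+1 n <= (1 / (1 + 1 / 2 * (p / (1 - p)))) * bin_cdf k n.
Proof.
move=> kn; have := bin_cdf_le_pmf kn.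
have p2 : 0 < 2 - p by rewrite subr_gt0; move: p1; lra.
have -> : 1 / (1 + 1 / 2 * (p / (1 - p))) = 1 - p / (2 - p).
  by field; rewrite !gt_eqF.
rewrite -ler_pdivrMl// bin_cdf_step mulrBl mul1r lerD2l lerN2 => H.
by rewrite -mulrA ler_pM2l.
Qed.

(** At [m] the bound 1/2 is Markov's inequality: the [m + 1] first tails are all
    at least the last one, and their sum is at most [(n + 1) / p]. *)
Lemma bin_cdf_tail m k n : (m <= k)%N -> 2 * n.+1%:R <= p * m.+1%:R ->
  bin_cdf k n <= 1 / 2 * (1 / (1 + 1 / 2 * (p / (1 - p)))) ^+ (k - m).
Proof.
move=> mk mn; rewrite -{1}(subnKC mk); elim: (k - m)%N => [|i IH]; last first.
  rewrite addnS exprS mulrCA; apply: (@le_trans _ _ (_ * bin_cdf (m + i) n)).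
    apply: bin_cdf_decay; apply: le_trans mn _.
    by rewrite ler_pM2l// ler_nat ltnS leq_addr.
  by rewrite ler_pM2l// divr_gt0// addr_gt0// mulr_gt0// divr_gt0.
rewrite addn0 expr0 mulr1.
have mS : m.+1%:R * bin_cdf m n <= \sum_(k < m.+1) bin_cdf k n.
  rewrite mulr_natl -[m.+1 in leLHS]card_ord -sumr_const ler_sum// => i _.
  by apply: bin_cdf_antitone; rewrite -ltnS.
have h : p * m.+1%:R * bin_cdf m n <= n.+1%:R.
  by rewrite -mulrA; apply: le_trans (sum_bin_cdf_le m.+1 n); rewrite ler_pM2l.
have {}h := le_trans (ler_wpM2r (bin_cdf_ge0 m n) mn) h.
rewrite -(ler_pM2l (ltr0Sn R n)); lra.
Qed.

End binomial_tail.

(** * Runs with conditionally likely successes *)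

Section generated_sigma_algebra.
Context (T : pointedType) (G : set (set T)).

Lemma gsigmaT : <<s G >> setT.
Proof. exact: (@measurableT _ (g_sigma_algebraType G)). Qed.

Lemma gsigmaI A B : <<s G >> A -> <<s G >> B -> <<s G >> (A `&` B).
Proof. exact: (@measurableI _ (g_sigma_algebraType G)). Qed.

Lemma gsigmaU A B : <<s G >> A -> <<s G >> B -> <<s G >> (A `|` B).
Proof. exact: (@measurableU _ (g_sigma_algebraType G)). Qed.

Lemma gsigmaD A B : <<s G >> A -> <<s G >> B -> <<s G >> (A `\` B).
Proof. exact: (@measurableD _ (g_sigma_algebraType G)). Qed.

End generated_sigma_algebra.

(** [D i] is the event that the run has not stopped at time [i], and [F i] the
    event that round [i] is a success; [<<s G i >>] is the information available
    before round [i]. *)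
Section domination.
Context (d : measure_display) (T : measurableType d) (R : realType).
Context (Q : probability T R) (p : R).
Context (G : nat -> set (set T)) (D F : nat -> set T).
Hypotheses (p0 : 0 < p) (p1 : p < 1).
Hypothesis G_meas : forall i A, <<s G i >> A -> measurable A.
Hypothesis G_mono : forall i, <<s G i >> `<=` <<s G i.+1 >>.
Hypothesis GD : forall i, <<s G i >> (D i).
Hypothesis GF : forall i, <<s G i.+1 >> (F i).
Hypothesis success_ge : forall i A, <<s G i >> A -> A `<=` D i ->
  p * fine (Q A) <= fine (Q (A `&` F i)).

Definition successes (i : nat) (t : T) : nat := \sum_(j < i) `[< F j t >].

Definition running (i : nat) : set T := [set t | forall j, (j <= i)%N -> D j t].

Let few i n : set T := [set t | (successes i t <= n)%N].

Let successesS i t : successes i.+1 t = (successes i t + `[< F i t >])%N.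
Proof. by rewrite /successes big_ord_recr. Qed.

Let few_step0 i : few i.+1 0%N = few i 0%N `\` F i.
Proof.
apply/seteqP; split=> t; rewrite /few/= successesS; case: asboolP => Ft.
- by rewrite addn1.
- by rewrite addn0.
- by case.
- by rewrite addn0; case.
Qed.

Let few_stepS i n : few i.+1 n.+1 = few i n `|` (few i n.+1 `\` F i).
Proof.
apply/seteqP; split=> t; rewrite /few/= successesS.
  case: asboolP => [_|]; first by rewrite addn1 ltnS; left.
  by rewrite addn0; right.
case: asboolP => [Ft|Ft] [h|[h h']]//; rewrite ?addn1 ?addn0//.
exact: leq_trans h _.
Qed.

Lemma running_history i : <<s G i >> (running i).
Proof.
elim: i => [|i IH].
  have -> : running 0 = D 0%N by apply/seteqP; split=> [t|t Dt j]; [exact|rewrite leqn0 => /eqP ->].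
  exact: GD.
have -> : running i.+1 = running i `&` D i.+1.
  apply/seteqP; split=> t.
    by move=> h; split; [move=> j ji; apply: h; exact: leqW|exact: h].
  by move=> [h1 h2] j; rewrite leq_eqVlt => /predU1P[->//|]; exact: h1.
by apply: gsigmaI => //; exact: G_mono.
Qed.

Let few_history i n : <<s G i >> (few i n).
Proof.
elim: i n => [|i IH] n.
  have -> : few 0 n = setT.
    by apply/seteqP; split=> // t _; rewrite /few/= /successes big_ord0.
  exact: gsigmaT.
have IH' m : <<s G i.+1 >> (few i m) by exact: G_mono.
case: n => [|n]; rewrite ?few_step0 ?few_stepS; first exact: gsigmaD.
by apply: gsigmaU => //; exact: gsigmaD.
Qed.

Let q (A : set T) : R := fine (Q A).

Let qD A B : measurable A -> measurable B -> q (A `\` B) = q A - q (A `&` B).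
Proof.
move=> mA mB; rewrite /q measureD ?fineB ?fin_num_measure//.
- exact: measurableI.
- by rewrite ltey_eq fin_num_measure.
Qed.

Let q_le A B : measurable A -> measurable B -> A `<=` B -> q A <= q B.
Proof.
by move=> mA mB AB; rewrite fine_le ?fin_num_measure// le_measure ?inE.
Qed.

(** Conditionally on the past, each round of a run that goes on is a success with
    probability at least [p], so the number of successes dominates a binomial
    variable: the left-hand sides satisfy, with inequalities, the recurrence
    [bin_cdf_rec]. *)
Lemma running_few_le i n :
  fine (Q (running i `&` [set t | (successes i t <= n)%N])) <= bin_cdf p i n.
Proof.
pose C i n := running i `&` few i n.
have GC j m : <<s G j >> (C j m).
  by apply: gsigmaI; [exact: running_history|exact: few_history].
have mC j m : measurable (C j m) by exact: G_meas (GC _ _).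
have mF j : measurable (F j) by exact: G_meas (GF _).
have CD j m : C j m `<=` D j by move=> t [h _]; exact: h.
rewrite -/(q _) -/(few i n) -/(C i n).
elim: i n => [|i IH] n.
  rewrite bin_cdf0//; have -> : 1 = q setT by rewrite /q probability_setT.
  by apply: q_le => //; exact: measurableT.
have runS : running i.+1 `<=` running i by move=> t h j ji; apply: h; exact: leqW.
case: n => [|n].
  apply: (@le_trans _ _ (q (C i 0%N `\` F i))).
    apply: q_le => //; first exact: measurableD.
    by rewrite /C few_step0 => t [h [h1 h2]]; split=> //; split=> //; exact: runS.
  rewrite qD// bin_cdf_rec0//.
  have := success_ge (GC i 0%N) (@CD _ _); rewrite -!/(q _).
  have := ler_wpM2l (_ : 0 <= 1 - p) (IH 0%N); rewrite subr_ge0 ltW// => /(_ isT).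
  by lra.
(* On [E] the count is exactly [n + 1], and one more success exceeds the bound. *)
pose E := C i n.+1 `\` C i n.
have CS : C i n `<=` C i n.+1 by move=> t [h1 h2]; split=> //; exact: leq_trans h2 _.
have mE : measurable E by exact: measurableD.
apply: (@le_trans _ _ (q (C i n.+1 `\` (E `&` F i)))).
  apply: q_le => //; first by apply: measurableD => //; exact: measurableI.
  rewrite {1}/C few_stepS => t [h hfew]; have ht := runS _ h; split.
    split=> //; case: hfew => [|[]//]; exact: leqW.
  move=> [[_ notn] Ft]; apply: notn; split=> //.
  by case: hfew => // -[].
rewrite qD//; last exact: measurableI.
have -> : C i n.+1 `&` (E `&` F i) = E `&` F i.
  by apply/setIidr => t [[]].
have qE : q E = q (C i n.+1) - q (C i n) by rewrite qD// (setIidr CS).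
have GE : <<s G i >> E by exact: gsigmaD.
have ED : E `<=` D i by move=> t [/CD].
have := success_ge GE ED; rewrite -!/(q _) qE bin_cdf_rec//.
have := ler_wpM2l (_ : 0 <= 1 - p) (IH n.+1); rewrite subr_ge0 ltW// => /(_ isT).
by have := ler_wpM2l (ltW p0) (IH n); lra.
Qed.

End domination.

(** * Expectation of a hitting time *)

Section first_time.
Context (d : measure_display) (T : measurableType d) (R : realType).
Context (Q : probability T R) (V : Type) (good : set V) (x : nat -> T -> V).
Let A (i : nat) : set T := [set t | forall j, (j <= i)%N -> ~ good (x j t)].
Hypothesis mA : forall i, measurable (A i).

(** A hitting time is the number of instants preceding it. *)
Lemma first_time_series (t : T) :
  first_time R good (x ^~ t) = (\sum_(i <oo) (\1_(A i) t)%:E)%E.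
Proof.
have [[k gk]|nog] := pselect (exists k, good (x k t)); last first.
  rewrite /first_time [X in ereal_inf X](_ : _ = set0) ?ereal_inf0; last first.
    by apply/seteqP; split=> // y [k gk _]; apply: nog; exists k.
  have At i : \1_(A i) t = 1 :> R.
    by rewrite indicE mem_set//= => j _ gj; apply: nog; exists j.
  apply/esym/eq_infty => r; pose K := (Num.truncn r).+1.
  apply: (@le_trans _ _ (\sum_(0 <= i < K) (\1_(A i) t : R)%:E)%E); last first.
    by apply: nneseries_lim_ge => i _ _; rewrite lee_fin.
  rewrite (eq_bigr (fun=> 1%E)) => [|i _]; last by rewrite At.
  rewrite sumEFin lee_fin big_const_nat iter_addr_0 subn0.
  exact/ltW/truncnS_gt.
have gkb : exists j, `[< good (x j t) >] by exists k; exact/asboolP.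
case: (ex_minnP gkb) => m /asboolP gm mmin.
rewrite (@nneseries_split _ _ 0%N m) => [|i _]; last by rewrite lee_fin.
rewrite add0n eseries0 => [|i mi _]; last first.
  by rewrite indicE memNset//= => /(_ m mi).
rewrite adde0 (eq_big_nat _ _ (F2 := fun=> 1%E)) => [|i im]; last first.
  rewrite indicE mem_set//= => j ji gj; have := mmin j (asboolT gj).
  by rewrite leqNgt (leq_ltn_trans ji).
rewrite sumEFin big_const_nat iter_addr_0 subn0.
apply/eqP; rewrite eq_le; apply/andP; split.
  by apply: ereal_inf_lbound; exists m.
apply: le_ereal_inf_tmp => _ [j gj <-]; rewrite lee_fin ler_nat.
by apply: mmin; exact/asboolP.
Qed.

Lemma integral_first_time_le (c : R) :
  (forall K, \sum_(i < K) fine (Q (A i)) <= c) ->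
  (\int[Q]_t first_time R good (x ^~ t) <= c%:E)%E.
Proof.
move=> Hc; rewrite (eq_integral (fun t => \sum_(i <oo) (\1_(A i) t : R)%:E)%E); last first.
  by move=> t _; exact: first_time_series.
rewrite integral_nneseries//; last first.
  by move=> i; apply/measurable_EFinP; exact: measurable_indic.
under eq_eseriesr do rewrite integral_indic// setIT.
apply: lime_le; first by apply: is_cvg_nneseries => i _ _; exact: measure_ge0.
apply: nearW => K; rewrite big_mkord.
rewrite (eq_bigr (fun i : 'I_K => (fine (Q (A i)))%:E)); last first.
  by move=> i _; rewrite fineK// fin_num_measure.
by rewrite sumEFin lee_fin; exact: Hc.
Qed.
End first_time.

(** * Independence of a minibatch from the past *)

Section independence.
Context (R : realType) (d d' : measure_display).
Context (T : measurableType d) (Omega : measurableType d').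
Context (Q : probability T R) (P : probability Omega R) (L : nat).
Context (W : nat -> 'I_L -> {RV Q >-> Omega}).
Hypothesis W_iid : iid_samples P W.

Lemma sample_history_measurable i A : sample_history W i A -> measurable A.
Proof.
apply: smallest_sub; first exact: sigma_algebra_measurable.
move=> _ [j [l [C [_ mC ->]]]].
by rewrite -[X in measurable X]setTI; exact: measurable_funPT.
Qed.

Lemma sample_history_mono i : sample_history W i `<=` sample_history W i.+1.
Proof.
apply: sub_smallest2r; first exact: smallest_sigma_algebra.
move=> _ [j [l [C [ji mC ->]]]].
by exists j, l, C; split=> //; exact: ltnW.
Qed.

Lemma sample_history_batch i l C : measurable C ->
  sample_history W i.+1 (W i l @^-1` C).
Proof. by move=> mC; apply: sub_sigma_algebra; exists i, l, C. Qed.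

(** Events prescribing each past sample separately form a pi-system that
    generates the history. *)
Let rectangle (i : nat) (B : nat * 'I_L -> set Omega) : set T :=
  [set t | forall k l, (k < i)%N -> B (k, l) (W k l t)].

Let rectangles (i : nat) : set (set T) :=
  [set A | exists2 B, (forall x, measurable (B x)) & A = rectangle i B].

Let batch_event (i : nat) (C : set Omega) : set T := [set t | forall l, C (W i l t)].

Let past i : seq (nat * 'I_L) := [seq (k, l) | k <- iota 0 i, l <- enum 'I_L].
Let present i : seq (nat * 'I_L) := [seq (i, l) | l <- enum 'I_L].

Let mem_past i x : (x \in past i) = (x.1 < i)%N.
Proof.
case: x => k l; apply/allpairsP/idP => [[[k' l'] /= [+ _ [-> _]]]|ki].
  by rewrite mem_iota.
by exists (k, l); rewrite /= mem_iota mem_enum.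
Qed.

Let mem_present i x : (x \in present i) = (x.1 == i).
Proof.
case: x => k l; apply/mapP/eqP => [[l' _ [-> _]]//|/= ->].
by exists l; rewrite ?mem_enum.
Qed.

Let uniq_rounds i : uniq (past i ++ present i).
Proof.
rewrite cat_uniq; apply/and3P; split.
- apply: allpairs_uniq; rewrite ?iota_uniq ?enum_uniq//.
  by move=> [? ?] [? ?] _ _ [-> ->].
- apply/hasPn => x; rewrite mem_present => /eqP xi.
  by rewrite /= mem_past xi ltnn.
- by rewrite map_inj_uniq ?enum_uniq// => ? ? [].
Qed.

Let rectangle_cap i B :
  rectangle i B = \bigcap_(x in [set` past i]) (W x.1 x.2 @^-1` B x).
Proof.
apply/seteqP; split=> [t h [k l]|t h k l ki]; last first.
  by apply: (h (k, l)); rewrite /= mem_past.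
by rewrite /= mem_past => ki; exact: h.
Qed.

Let measurable_W k l C : measurable C -> measurable (W k l @^-1` C).
Proof. by move=> mC; rewrite -[X in measurable X]setTI; exact: measurable_funPT. Qed.

Let rectangle_batch i B C : (forall x, measurable (B x)) -> measurable C ->
  (Q (rectangle i B `&` batch_event i C) =
   Q (rectangle i B) * \prod_(l < L) P C)%E.
Proof.
move=> mB mC; have [distW indep] := W_iid.
pose B' x := if x.1 == i then C else B x.
have mB' x : measurable (B' x) by rewrite /B'; case: ifP.
have rectE : rectangle i B = rectangle i B'.
  apply/seteqP; split=> t h k l ki.
    by rewrite /B' /= (ltn_eqF ki); exact: h.
  by have := h k l ki; rewrite /B' /= (ltn_eqF ki).
have -> : rectangle i B `&` batch_event i C =
    \bigcap_(x in [set` past i ++ present i]) (W x.1 x.2 @^-1` B' x).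
  rewrite rectE; apply/seteqP; split=> t.
    move=> [h1 h2] [k l]; rewrite /= mem_cat mem_past mem_present /= => /orP[|/eqP ->].
      exact: h1.
    by rewrite /B' /= eqxx; exact: h2.
  move=> h; split=> [k l ki|l].
    by apply: (h (k, l)); rewrite /= mem_cat mem_past ki.
  have := h (i, l); rewrite /= mem_cat mem_present eqxx orbT => /(_ isT).
  by rewrite /B' /= eqxx.
rewrite (indep _ _ (uniq_rounds i)) => [|x _]; last exact: mB'.
rewrite rectE rectangle_cap (indep (past i) B') => [||x _]; last exact: mB'.
  rewrite big_cat/=; congr (_ * _)%E.
  rewrite /present big_map big_enum; apply: eq_bigr => l _ /=.
  by rewrite /B' /= eqxx; exact: distW.
by have := uniq_rounds i; rewrite cat_uniq => /andP[].
Qed.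

(** Both sides are finite measures in [A], equal on rectangles by mutual
    independence, hence on the sigma-algebra that rectangles generate. *)
Lemma history_batch_indep i A C : sample_history W i A -> measurable C ->
  (Q (A `&` [set t | forall l, C (W i l t)]) = Q A * \prod_(l < L) P C)%E.
Proof.
move=> hA mC; rewrite -/(batch_event i C).
have mE : measurable (batch_event i C).
  have -> : batch_event i C = \bigcap_(l in [set: 'I_L]) (W i l @^-1` C).
    by apply/seteqP; split=> [t h l _|t h l]; exact: h.
  by apply: fin_bigcap_measurable => // l _; exact: measurable_W.
have cE : (\prod_(l < L) P C)%E = ((fine (P C)) ^+ L)%:E.
  rewrite (eq_bigr (fun=> (fine (P C))%:E)) => [|l _]; last first.
    by rewrite fineK// fin_num_measure.
  by rewrite prodEFin prodr_const card_ord.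
have c0 : 0 <= fine (P C) ^+ L by rewrite exprn_ge0// fine_ge0.
pose m1 : {measure set T -> \bar R} := mrestr Q mE.
pose m2 : {measure set T -> \bar R} := mscale (NngNum c0) Q.
have m12 B : (forall x, measurable (B x)) -> m1 (rectangle i B) = m2 (rectangle i B).
  move=> mB; transitivity (Q (rectangle i B `&` batch_event i C)) => //.
  by rewrite rectangle_batch// cE muleC.
have rectT : rectangle i (fun=> setT) = setT by apply/seteqP; split.
have mrect B : (forall x, measurable (B x)) -> measurable (rectangle i B).
  by move=> mB; rewrite rectangle_cap; apply: fin_bigcap_measurable => // x _; exact: measurable_W.
suff m12A : m1 A = m2 A by rewrite cE muleC; exact: m12A.
  apply: (@g_sigma_algebra_measure_unique_trace _ _ _ (rectangles i) setT measurableT _ _ m1 m2).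
  - by move=> _ [[B mB ->] _]; exact: mrect.
  - move=> _ _ [[B mB ->] _] [[B' mB' ->] _]; split=> //.
    exists (fun x => B x `&` B' x); first by move=> x; exact: measurableI.
    apply/seteqP; split=> t; first by move=> [h h'] k l ki; split; [exact: h|exact: h'].
    by move=> h; split=> k l ki; have [] := h k l ki.
  - by rewrite -rectT m12.
  - by move=> _ [[B mB ->] _]; exact: m12.
  - by rewrite [m1 _]/(Q (setT `&` batch_event i C)) setTI (le_lt_trans (probability_le1 Q mE)) ?ltry.
  - by [].
  - move: A hA; apply: sub_smallest2r; first exact: smallest_sigma_algebra.
    move=> _ [j [l [C' [ji mC' ->]]]]; split=> //.
    exists (fun x => if x == (j, l) then C' else setT).
      by move=> x; case: ifP.
    apply/seteqP; split=> t h.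
      by move=> k l' ki; case: ifP => // /eqP[-> ->].
    by have := h j l ji; rewrite eqxx.
Qed.

End independence.

(** * Successes of the algorithm *)

Lemma continuous_growth_level (R : realType) (eps delta a : R) :
  continuous (growth_level eps delta a).
Proof.
move=> r; rewrite /growth_level.
have m0 s : 0 < Num.max 1 (s / delta) by rewrite lt_max ltr01.
rewrite (_ : (fun s => _) = fun s => eps * expR (a * ln (Num.max 1 (s / delta)))).
  have c1 : {for r, continuous (fun s : R => Num.max 1 (s / delta))}.
    apply: (@continuous_max R R (cst 1) (fun s => s / delta)); first exact: cvg_cst.
    by apply: cvgMr_tmp; exact: cvg_id.
  have c2 : {for r, continuous (fun s : R => ln (Num.max 1 (s / delta)))}.
    exact: (continuous_comp c1 (continuous_ln (m0 r))).
  have c3 : {for r, continuous (fun s : R => a * ln (Num.max 1 (s / delta)))}.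
    exact: cvgMl_tmp.
  apply: cvgMl_tmp.
  exact: (continuous_comp c3 (@continuous_expR R _)).
by apply/funext => s; rewrite /powR gt_eqF.
Qed.

Section progress.
Context (R : realType) (n : nat) (dO : measure_display).
Context (Omega : measurableType dO) (P : probability Omega R).
Context (f : Omega -> 'rV[R]_n -> R) (g : Omega -> 'rV[R]_n -> 'rV[R]_n).
Hypothesis f_meas : forall x, measurable_fun setT (fun w => f w x).
Hypothesis g_subgrad : forall w x, subdifferential (f w) x (g w x).
Hypothesis X0 : feasible_set f !=set0.
Context (x0 z0 : 'rV[R]_n) (M : R).
Let B := eball z0 (enorm (x0 - z0)).
Hypothesis f_lipschitz : forall w, exists U : set 'rV[R]_n,
  [/\ open U, B `<=` U & elipschitz_on M U (f w)].
Hypothesis M0 : 0 < M.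
Let X := feasible_set f.

Lemma subgradient_ball_le w x : B x -> enorm (g w x) <= M.
Proof.
move=> Bx; have [U [oU BU hL]] := f_lipschitz w.
exact: (subgradient_enorm_le (ltW M0) oU (BU _ Bx) hL).
Qed.

Lemma constraint_lip w x y : B x -> B y -> f w x <= f w y + M * enorm (x - y).
Proof.
move=> Bx By; have [U [oU BU hL]] := f_lipschitz w.
have := le_trans (ler_norm _) (hL _ _ (BU _ Bx) (BU _ By)); lra.
Qed.

Lemma measurable_sublevel x c : measurable [set w | f w x <= c].
Proof.
rewrite (_ : [set w | _] = setT `&` (fun w => f w x) @^-1` [set` `]-oo, c]]).
  by apply: f_meas.
by rewrite setTI; apply/seteqP; split=> w; rewrite /= in_itv.
Qed.

Lemma measurable_superlevel x c : measurable [set w | c <= f w x].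
Proof.
rewrite (_ : [set w | _] = setT `&` (fun w => f w x) @^-1` [set` `[c, +oo[]).
  by apply: f_meas.
by rewrite setTI; apply/seteqP; split=> w; rewrite /= in_itv/= andbT.
Qed.

(** Relative closedness in the ball of the set of good points, needed for the
    measurability of stopping events. The Lipschitz bound places the event
    [near_satisfied f y eps] inside the same event at [x] with a slightly larger
    [eps], and [P] is continuous from above. *)
Lemma near_not_good (eps : R) (c : \bar R) x : B x ->
  ~ (c <= P (near_satisfied f x eps))%E ->
  \forall y \near x, B y -> ~ (c <= P (near_satisfied f y eps))%E.
Proof.
move=> Bx /negP; rewrite -ltNge => Pc.
pose S (k : nat) := near_satisfied f x (eps + M * k.+1%:R^-1).
have mS k : measurable (S k) by exact: measurable_sublevel.
have capS : \bigcap_k S k = near_satisfied f x eps.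
  apply/seteqP; split=> w; rewrite /near_satisfied/=; last first.
    by move=> fw k _; apply: le_trans fw _; rewrite lerDl mulr_ge0 ?invr_ge0 ?ltW.
  move=> h; apply/ler_addgt0Pr => e e0.
  pose k := Num.truncn (M / e); apply: le_trans (h k I) _.
  rewrite lerD2l ler_pdivrMr// mulrC -ler_pdivrMr//.
  exact/ltW/truncnS_gt.
have : P \o S @ \oo --> P (\bigcap_k S k).
  apply: nonincreasing_cvg_mu => //.
  - by rewrite (le_lt_trans (probability_le1 P (mS 0%N))) ?ltry.
  - by rewrite capS; exact: measurable_sublevel.
  - move=> k m km; apply/subsetPset => w; rewrite /S /near_satisfied/= => /le_trans; apply.
    by rewrite lerD2l ler_pM2l// lef_pV2 ?posrE// ler_nat.
rewrite capS => cvgS.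
have [k Sk] : exists k, (P (S k) < c)%E.
  apply: contrapT => nS; have : (c <= lim (P \o S @ \oo))%E.
    apply: lime_ge; first by apply/cvg_ex; eexists; exact: cvgS.
    apply: nearW => k /=; rewrite leNgt; apply/negP => Sk; apply: nS; by exists k.
  by rewrite (cvg_lim _ cvgS)// leNgt Pc.
near=> y => By; apply/negP; rewrite -ltNge; apply: le_lt_trans Sk.
have yx : enorm (y - x) < k.+1%:R^-1 by near: y; exact: near_enorm.
apply: le_measure; rewrite ?inE//; first exact: measurable_sublevel.
move=> w; rewrite /near_satisfied /S/= => fy.
apply: le_trans (constraint_lip w Bx By) _.
by rewrite enorm_distC lerD// ler_pM2l// ltW.
Unshelve. all: by end_near. Qed.

Context (mu a Delta : R).
Hypotheses (mu0 : 0 < mu) (a1 : 1 <= a).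
Hypothesis growth : growth_assumption P f B mu a Delta.
Context (eps Gamma : R).
Hypotheses (eps0 : 0 < eps) (Gamma0 : 0 < Gamma) (Gamma_lt : Gamma < Delta).
Let delta := (eps / mu) `^ (1 / a).
Let good := [set y : 'rV[R]_n |
  ((1 - Gamma)%R%:E <= P (near_satisfied f y eps))%E].
Let close := [set y : 'rV[R]_n | edistance y X <= delta].
Let thr y := growth_level eps delta a (edistance y X).

Let a0 : 0 < a. Proof. exact: lt_le_trans a1. Qed.

Let delta0 : 0 < delta. Proof. by rewrite powR_gt0// divr_gt0. Qed.

Let deltaE : mu * delta `^ a = eps.
Proof.
rewrite /delta -powRrM mul1r mulVf ?gt_eqF// powRr1 ?divr_ge0 ?ltW//.
by rewrite mulrC divfK// gt_eqF.
Qed.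

(** At a point that is not close to the feasible set, the growth level is
    [mu * edistance y X `^ a], and the growth assumption gives a probability of at
    least [Delta]. At a close point it is [eps], and not being good means that
    [eps] is exceeded with probability more than [Gamma]. *)
Lemma not_done_success_prob y : B y -> ~ (good `&` close) y ->
  (Gamma%:E <= P [set w | thr y <= f w y]%R)%E.
Proof.
move=> By nd; have [cl|ncl] := leP (edistance y X) delta.
  have ng : ~ good y by move=> gy; apply: nd.
  have thrE : thr y = eps.
    rewrite /thr /growth_level (_ : Num.max 1 _ = 1) ?powR1 ?mulr1//.
    by apply/max_idPl; rewrite ler_pdivrMr// mul1r.
  have mN : measurable (near_satisfied f y eps) by exact: measurable_sublevel.
  move: ng; rewrite /good/= => /negP; rewrite -ltNge => ng.
  apply: (@le_trans _ _ (P (~` near_satisfied f y eps))).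
    rewrite probability_setC//; move: ng.
    rewrite -(fineK (fin_num_measure P _ mN)) -EFinB lte_fin lee_fin; lra.
  apply: le_measure; rewrite ?inE//; [exact: measurableC|exact: measurable_superlevel|].
  by move=> w /= /negP; rewrite -ltNge thrE => /ltW.
have nX : ~ X y.
  move=> Xy; have := edistance_le y Xy; rewrite subrr (eqP (_ : enorm 0 == 0)) ?enorm_eq0//.
  by rewrite leNgt (lt_trans delta0).
have thrE : thr y = mu * edistance y X `^ a.
  rewrite /thr /growth_level (_ : Num.max 1 _ = edistance y X / delta); last first.
    by apply/max_idPr; rewrite ler_pdivlMr// mul1r ltW.
  have -> : edistance y X `^ a = (edistance y X / delta) `^ a * delta `^ a.
    rewrite -powRM ?divfK ?gt_eqF ?(ltW delta0)// divr_ge0 ?(ltW delta0)//.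
    exact: edistance_ge0.
  by rewrite mulrCA deltaE mulrC.
rewrite thrE; apply: (le_trans _ (growth By nX)).
by rewrite lee_fin ltW.
Qed.

Lemma not_done_edistance y : B y -> ~ (good `&` close) y ->
  eps <= M * edistance y X.
Proof.
move=> By nd; have [[w fw]|no] := pselect (exists w, thr y <= f w y).
  apply: le_trans (growth_level_ge_eps _ _ eps0 a1) _.
  exact: le_trans fw (constraint_le_edistance g_subgrad X0 M0 (subgradient_ball_le _ By)).
have := not_done_success_prob By nd; rewrite (_ : [set w | _] = set0).
  by rewrite measure0 lee_fin leNgt Gamma0.
by apply/seteqP; split=> // w fw; apply: no; exists w.
Qed.

Lemma near_not_done y : B y -> ~ (good `&` close) y ->
  \forall y' \near y, B y' -> ~ (good `&` close) y'.
Proof.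
move=> By nd; have [gy|ng] := pselect (good y); last first.
  by apply: filterS (near_not_good By ng) => y' h By' [gy' _]; exact: h By' gy'.
have : delta < edistance y X.
  by rewrite ltNge; apply/negP => cl; exact: nd.
move=> /(cvgr_gt _ (continuous_edistance X0 (x := y))) H.
near=> y' => _ [_]; rewrite /close/= leNgt => /negP; apply.
by near: y'.
Unshelve. all: by end_near. Qed.

(** By continuity of the growth level, a sample that is successful at one point
    of a small enough cell is almost successful at all its points. *)
Lemma local_success c : exists O : set 'rV[R]_n,
  [/\ open O, B c -> O c & forall w x y, B x -> B y -> O x -> O y ->
    thr y <= f w y -> 9 / 10 * thr x <= f w x].
Proof.
(* The transfer loses less than [3 * eta], within the tenth of the growth level,
   at least [eps / 10], that is given up. *)
pose eta := eps / 40; have eta0 : 0 < eta by rewrite divr_gt0.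
have cthr : {for c, continuous thr}.
  apply: (@continuous_comp _ _ _ (fun y => edistance y X) (growth_level eps delta a)).
    exact: continuous_edistance.
  exact: continuous_growth_level.
exists (interior [set x | `|thr c - thr x| < eta /\ M * enorm (x - c) < eta / 2]).
split; first exact: open_interior.
  move=> _; near=> x; split.
    by near: x; move: cthr => /cvgrPdist_lt; exact.
  rewrite mulrC -ltr_pdivlMr//; near: x; apply: near_enorm.
  by rewrite !divr_gt0.
move=> w x y Bx By /interior_subset[xc xM] /interior_subset[yc yM] fy.
have := constraint_lip w By Bx.
have := ler_wpM2l (ltW M0) (ler_enorm_dist y c x); rewrite (enorm_distC c x) mulrDr.
have := growth_level_ge_eps delta (edistance c X) eps0 a1; rewrite -/(thr c).
move: xc; rewrite ltr_norml => /andP[xc _].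
move: yc; rewrite ltr_norml => /andP[_ yc].
move: eps0 xM yM xc yc fy; rewrite /eta.
move: (thr c) (thr x) (thr y) => tc tx ty; lra.
Unshelve. all: by end_near. Qed.

Context (L : nat) (sel : 'rV[R]_n -> ('I_L -> Omega) -> 'I_L).
Hypothesis sel_argmax : argmax_rule f sel.
Context (dT : measure_display) (T : measurableType dT) (Q : probability T R).
Context (W : nat -> 'I_L -> {RV Q >-> Omega}).
Hypothesis W_iid : iid_samples P W.
Let x k t := polyakFM f g sel x0 (fun j l => W j l t) k.
Hypothesis x_meas : measurable_iterates W x.
Hypothesis Xz0 : X z0.
Hypothesis Gamma1 : Gamma < 1.
Let p := batch_prob Gamma L.
Let not_done i : set T := [set t | ~ (good `&` close) (x i t)].

Let xB k t : B (x k t).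
Proof. exact: polyakFM_eball. Qed.

(** All iterates lie in the ball, so openness relative to the ball suffices. *)
Lemma iterate_history (S : set 'rV[R]_n) i :
  (forall y, B y -> ~ S y -> \forall y' \near y, B y' -> ~ S y') ->
  sample_history W i [set t | ~ S (x i t)].
Proof.
move=> nearS; pose O := interior [set y | B y -> ~ S y].
have -> : [set t | ~ S (x i t)] = x i @^-1` O.
  apply/seteqP; split=> t; first by move=> nS; exact: nearS.
  by move=> /interior_subset; exact.
by apply: x_meas; exact: open_interior.
Qed.

Let success_at y i : set T := [set t | exists l, thr y <= f (W i l t) y].

Let success_at_setC y i :
  success_at y i = ~` [set t | forall l, (~` [set w | thr y <= f w y]) (W i l t)].
Proof.
apply/seteqP; split=> t; first by move=> [l h] /(_ l); exact.
by move=> /existsNP[l /contrapT h]; exists l.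
Qed.

Lemma success_at_history y i : sample_history W i.+1 (success_at y i).
Proof.
rewrite (_ : success_at y i =
    \big[setU/set0]_(l <- enum 'I_L) (W i l @^-1` [set w | thr y <= f w y])).
  apply: big_ind.
  - by rewrite -(setDv setT); apply: gsigmaD; exact: gsigmaT.
  - by move=> A A' ? ?; exact: gsigmaU.
  - by move=> l _; apply: sample_history_batch; exact: measurable_superlevel.
rewrite -bigcup_seq; apply/seteqP; split=> t.
  by move=> [l h]; exists l; rewrite //= mem_enum.
by move=> [l _ h]; exists l.
Qed.

(** A round fails when its [L] independent samples all fail, with probability at
    most [(1 - Gamma) ^+ L]. *)
Lemma batch_success_prob y i A : B y -> ~ (good `&` close) y ->
  sample_history W i A -> p * fine (Q A) <= fine (Q (A `&` success_at y i)).
Proof.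
move=> By nd hA; have mA := sample_history_measurable hA.
pose C := ~` [set w | thr y <= f w y].
have mC : measurable C by apply: measurableC; exact: measurable_superlevel.
have PC : fine (P C) <= 1 - Gamma.
  have := not_done_success_prob By nd.
  have mS := measurable_superlevel y (thr y).
  rewrite /C probability_setC// -(fineK (fin_num_measure P _ mS)) lee_fin /= => h.
  by rewrite lerD2l lerN2.
have mE : measurable (success_at y i).
  exact: sample_history_measurable (@success_at_history y i).
have indep := history_batch_indep W_iid hA mC.
set N := [set t | forall l, C (W i l t)] in indep.
have mN : measurable N by rewrite -(setCK N) -success_at_setC; exact: measurableC.
have -> : A `&` success_at y i = A `\` N by rewrite success_at_setC setDE.
have QD : Q (A `\` N) = (Q A - Q (A `&` N))%E.
  by rewrite measureD// (le_lt_trans (probability_le1 Q mA)) ?ltry.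
have PCL : (\prod_(l < L) P C)%E = (fine (P C) ^+ L)%:E.
  rewrite (eq_bigr (fun=> (fine (P C))%:E)) => [|l _]; last first.
    by rewrite fineK// fin_num_measure.
  by rewrite prodEFin prodr_const card_ord.
rewrite QD indep PCL -[in leRHS](fineK (fin_num_measure Q _ mA)) -EFinM -EFinB /=.
have q0 : 0 <= fine (Q A) by rewrite fine_ge0.
have : fine (P C) ^+ L <= (1 - Gamma) ^+ L.
  by rewrite lerXn2r ?nnegrE ?fine_ge0// subr_ge0 ltW.
move=> /(ler_wpM2l q0); rewrite /p /batch_prob; lra.
Qed.

(** Independence only applies to a minibatch tested at a deterministic point, not
    at the random iterate. The compact ball is therefore covered by finitely many
    small cells, and the samples are tested at a representative of the cell that
    contains the iterate. The cells are handled one after the other, so that they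
    need not be disjoint. *)
Lemma success_event i : exists F : set T,
  [/\ sample_history W i.+1 F,
      forall t, F t -> exists l, 9 / 10 * thr (x i t) <= f (W i l t) (x i t) &
      forall A, sample_history W i A -> A `<=` not_done i ->
        p * fine (Q A) <= fine (Q (A `&` F))].
Proof.
have [V V_spec] := choice local_success.
have openV c : open (V c) by have [] := V_spec c.
have VB c : B c -> V c c by have [] := V_spec c.
have succO c w y y' : B y -> B y' -> V c y -> V c y' ->
    thr y' <= f w y' -> 9 / 10 * thr y <= f w y.
  by have [_ _] := V_spec c; exact.
have [s sB] : exists s : seq 'rV[R]_n, forall y, B y -> exists2 c, c \in s & V c y.
  have [s _ sB] : finite_subset_cover B V B.
    have := @eball_compact R n z0 (enorm (x0 - z0)); rewrite compact_cover; apply.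
      by move=> c _; exact: openV.
    by move=> c Bc; exists c => //; exact: VB.
  by exists (finmap.enum_fset s) => y /sB[c cs Vc]; exists c.
have hO c : sample_history W i (x i @^-1` V c) by apply: x_meas.
suff [F [hF succF pF]] : exists F : set T,
  [/\ sample_history W i.+1 F,
      forall t, F t -> exists l, 9 / 10 * thr (x i t) <= f (W i l t) (x i t) &
      forall A, sample_history W i A -> A `<=` not_done i ->
        (forall t, A t -> exists2 c, c \in s & V c (x i t)) ->
        p * fine (Q A) <= fine (Q (A `&` F))].
  exists F; split=> // A hA And; apply: pF => // t _.
  exact: sB (xB i t).
elim: s {sB} => [|c s' [F [hF succF pF]]].
  exists set0; split=> //; first by rewrite -(setDv setT); apply: gsigmaD; exact: gsigmaT.
  move=> A hA _ A0; rewrite (_ : A = set0) ?set0I ?measure0 ?mulr0//.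
  by apply/seteqP; split=> // t /A0[].
have hOc := sample_history_mono (hO c).
(* What the remaining cells already guarantee, used away from the cell [c]. *)
have cell A : sample_history W i A -> A `<=` not_done i ->
    (forall t, A t -> exists2 c', c' \in c :: s' & V c' (x i t)) ->
    p * fine (Q (A `\` x i @^-1` V c)) <= fine (Q ((A `\` x i @^-1` V c) `&` F)).
  move=> hA And Acov; apply: pF; first exact: (gsigmaD hA (hO c)).
    by move=> t [/And].
  move=> t [/Acov[c' +]]; rewrite inE => /predU1P[->//|c's Oc' _].
  by exists c'.
have [[y [By nd Oy]]|none] := pselect (exists y, [/\ B y, ~ (good `&` close) y & V c y]).
  exists ((x i @^-1` V c `&` success_at y i) `|` (F `\` x i @^-1` V c)); split.
  - apply: gsigmaU; last exact: (gsigmaD hF hOc).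
    exact: (gsigmaI hOc (@success_at_history y i)).
  - by move=> t [[Ot [l h]]|[/succF//]]; exists l; exact: (succO c _ _ _ (xB i t) By Ot Oy h).
  - move=> A hA And Acov; have mA := sample_history_measurable hA.
    have mO := sample_history_measurable (hO c).
    have mF := sample_history_measurable hF.
    have mS := sample_history_measurable (@success_at_history y i).
    have := batch_success_prob By nd (gsigmaI hA (hO c)).
    have := cell A hA And Acov.
    have splitQ E E' : measurable E -> measurable E' -> E `&` E' = set0 ->
        fine (Q (E `|` E')) = fine (Q E) + fine (Q E').
      by move=> mE mE' EE'; rewrite measureU// fineD ?fin_num_measure.
    rewrite -[X in _ -> _ -> p * fine (Q X) <= _](setUIDK A (x i @^-1` V c)).
    have -> : A `&` (x i @^-1` V c `&` success_at y i `|` F `\` x i @^-1` V c) =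
        (A `&` x i @^-1` V c `&` success_at y i) `|` ((A `\` x i @^-1` V c) `&` F).
      by rewrite setIUr setIA !setDE -[in RHS](setIA A (~` _)) (setIC (~` _)).
    have disj E E' : (E `&` x i @^-1` V c `&` E') `&` ((A `\` x i @^-1` V c) `&` F) = set0.
      by apply/seteqP; split=> // t [[[_ Vt] _] [[_ nVt] _]]; exact: nVt Vt.
    rewrite !splitQ; [lra| | | | | |].
    - by apply: measurableI => //; exact: measurableI.
    - by apply: measurableI => //; exact: measurableD.
    - exact: disj.
    - exact: measurableI.
    - exact: measurableD.
    - by apply/seteqP; split=> // t [[_ Vt] [_ nVt]]; exact: nVt Vt.
(* A cell without representative is never visited before stopping. *)
exists F; split=> // A hA And Acov; apply: pF => // t At.
have [c' + Oc'] := Acov t At; rewrite inE => /predU1P[c'c|]; last by exists c'.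
by case: none; exists (x i t); split; [exact: xB|exact: And|rewrite -c'c].
Qed.

Hypothesis L1 : (1 <= L)%N.
Let D0 := edistance x0 X.
Let E' := iteration_bound M mu a eps p D0.

Let p0 : 0 < p.
Proof.
by rewrite subr_gt0 exprn_ilt1 -?lt0n// ?subr_ge0 ?(ltW Gamma1)// gtrBl.
Qed.

Lemma iteration_boundE :
p * E' = 4 + 4 * (M * delta / eps) ^+ 2 * growth_min a (M * D0 / eps).
Proof.
have -> : M * delta / eps = M / (mu `^ (1 / a) * eps `^ (1 - 1 / a)).
  have dmu : delta * mu `^ (1 / a) = eps `^ (1 / a).
    by rewrite /delta -powRM ?divr_ge0 ?(ltW eps0) ?(ltW mu0)// divfK// gt_eqF.
  rewrite powRB ?(gt_eqF eps0) ?implybT// powRr1 ?(ltW eps0)// -dmu.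
  by field; rewrite !gt_eqF// powR_gt0.
by rewrite /E' /iteration_bound mulrA [p * _]mulrC divfK ?gt_eqF// mulrDr mulr1 mulrA.
Qed.

(** Both counts hold when [1 < a], and only the logarithmic one when [a = 1],
    which is how [growth_min] is defined. *)
Lemma successes_lt (F : nat -> set T) k t :
  (forall i t, F i t -> exists l, 9 / 10 * thr (x i t) <= f (W i l t) (x i t)) ->
  running not_done k t -> (successes F k t)%:R + 4 <= p * E'.
Proof.
move=> succF run; pose d i := edistance (x i t) X.
have d0 i : 0 <= d i by exact: edistance_ge0.
have d_mono i : (i < k)%N -> d i.+1 <= d i by move=> _; exact: edistance_step_fejer.
have d_succ i : (i < k)%N -> `[< F i t >] ->
    d i.+1 ^+ 2 <= d i ^+ 2 - (9 / 10 * growth_level eps delta a (d i) / M) ^+ 2.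
  move=> _ /asboolP/succF[l h].
  apply: (edistance_step_descent g_subgrad sel_argmax X0 M0 _ _ h).
    by move=> w; exact: subgradient_ball_le.
  rewrite mulr_gt0// ?divr_gt0//.
  exact: lt_le_trans (growth_level_ge_eps _ _ eps0 a1).
have dk : eps <= M * d k by apply: not_done_edistance => //; exact: run.
have hlog := success_count_log eps0 delta0 M0 a1 d0 d_mono d_succ dk.
rewrite iteration_boundE.
rewrite addrC lerD2l /growth_min; case: eqVneq => // a_neq1.
have a_gt1 : 1 < a by rewrite lt_neqAle eq_sym a_neq1.
have hgrowth := success_count_growth eps0 delta0 M0 a1 d0 d_mono d_succ a_gt1.
by rewrite minEle; case: ifP.
Qed.

Hypothesis eps_lt : eps < M * D0.

Lemma iteration_bound_ge : 4 <= p * E'.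
Proof.
rewrite iteration_boundE lerDl mulr_ge0//; first by rewrite mulr_ge0// sqr_ge0.
have l0 : 0 <= log2 (M * D0 / eps).
  by rewrite divr_ge0 ?ln_ge0 ?ler1n// ler_pdivlMr// mul1r ltW.
rewrite /growth_min; case: (eqVneq a 1) => //= _.
rewrite le_min l0 andbT divr_ge0// subr_ge0 powR_ge1 ?ler1n//.
by rewrite subr_ge0 ler_pdivrMr ?mul1r.
Qed.

Let p1 : p < 1.
Proof. by rewrite gtrBl exprn_gt0// subr_gt0. Qed.

Let rounds (i : nat) : set (set T) := [set C | exists j l A,
  [/\ (j < i)%N, measurable A & C = W j l @^-1` A]].

(** [budget.+1 <= p * E'] is the form in which sums of binomial tails are
    bounded, and by [successes_lt] a run that goes on never exceeds [budget]. *)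
Let budget : nat := (Num.truncn (p * E')).-1.

Let budget_le : budget.+1%:R <= p * E'.
Proof.
have pE := iteration_bound_ge; rewrite /budget prednK.
  by rewrite truncn_le// (le_trans _ pE).
by rewrite truncn_gt0 (le_trans _ pE)// ler1n.
Qed.

(** On runs that have not stopped the number of successes is within the budget,
    so the condition on it in [running_few_le] is automatic. *)
Lemma running_not_done_le k :
  measurable (running not_done k) /\
  fine (Q (running not_done k)) <= bin_cdf p k budget.
Proof.
have [F F_spec] := choice success_event.
have succF i t : F i t -> exists l, 9 / 10 * thr (x i t) <= f (W i l t) (x i t).
  by have [_ + _] := F_spec i; exact.
have GD i : <<s rounds i >> (not_done i).
  by apply: iterate_history => y; exact: near_not_done.
have mono i : <<s rounds i >> `<=` <<s rounds i.+1 >> by exact: sample_history_mono.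
have hist := running_history mono GD.
split; first exact: sample_history_measurable (hist k).
have -> : running not_done k = running not_done k `&`
    [set t | (successes F k t <= budget)%N].
  apply/esym/setIidl => t run /=.
  have := successes_lt succF run; rewrite /budget => h.
  rewrite -ltnS prednK; last by rewrite truncn_gt0 (le_trans _ iteration_bound_ge)// ler1n.
  rewrite truncn_ge_nat; last by rewrite (le_trans _ iteration_bound_ge).
  by rewrite -natr1; apply: le_trans h; rewrite lerD2l ler1n.
apply: (@running_few_le _ _ _ _ _ rounds) => //.
- by move=> i A; exact: sample_history_measurable.
- by move=> i; have [] := F_spec i.
- by move=> i A hA And; have [_ _] := F_spec i; exact.
Qed.

Lemma expected_first_time_le :
  (\int[Q]_t first_time R (good `&` close) (x ^~ t) <= E'%:E)%E.
Proof.
apply: integral_first_time_le => [i|K]; first by have [] := running_not_done_le i.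
rewrite -(ler_pM2l p0); apply: le_trans budget_le.
apply: le_trans (sum_bin_cdf_le p0 p1 K budget); rewrite ler_pM2l//.
by apply: ler_sum => i _; have [] := running_not_done_le i.
Qed.

(** A first good iterate at [k.+1] forces the run not to have stopped at [k]; the
    shift by one matches [m.+1], the rounded value of [2 * E']. *)
Lemma first_good_le k : 2 * E' <= k%:R ->
  (Q [set t | is_first good (x ^~ t) k] <=
   (1 / 2 * (1 / (1 + 1 / 2 * (p / (1 - p))))
              ^ (k%:Z - Num.ceil (2 * E')))%R%:E)%E.
Proof.
move=> kE; have E0 : 0 < E'.
  by rewrite -(pmulr_rgt0 _ p0); apply: lt_le_trans iteration_bound_ge.
case: k kE => [|k] kE.
  by move: kE; rewrite leNgt mulr_gt0.
have [m mE] : exists m : nat, Num.ceil (2 * E') = m.+1.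
  have : 0 < Num.ceil (2 * E') by rewrite ceil_gt0 mulr_gt0.
  by case: (Num.ceil _) => // -[//|m] _; exists m.
have mk : (m <= k)%N.
  by rewrite -ltnS -lez_nat -mE ceil_le_int.
have mb : 2 * budget.+1%:R <= p * m.+1%:R.
  apply: (@le_trans _ _ (p * (2 * E'))).
    by rewrite mulrCA ler_pM2l//; exact: budget_le.
  by rewrite ler_pM2l//; have := ceil_ge (2 * E'); rewrite mE.
rewrite mE subzn ?ltnS// subSS.
have notgood_history i : <<s rounds i >> [set t | ~ good (x i t)].
  apply: iterate_history => y; exact: near_not_good.
have mono i : <<s rounds i >> `<=` <<s rounds i.+1 >> by exact: sample_history_mono.
have hist := running_history mono notgood_history.
have -> : [set t | is_first good (x ^~ t) k.+1] =
    running (fun i => [set t | ~ good (x i t)]) k `\`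
    running (fun i => [set t | ~ good (x i t)]) k.+1.
  apply/seteqP; split=> t.
    move=> [gk ngj]; split; first by move=> j jk; exact: ngj.
    by move=> /(_ _ (leqnn _)).
  move=> [ngj ng]; split; last by move=> j jk; exact: ngj.
  apply: contrapT => ngk; apply: ng => j; rewrite leq_eqVlt => /predU1P[->//|jk].
  exact: ngj.
have [mr rle] := running_not_done_le k.
apply: (@le_trans _ _ (Q (running not_done k))).
  apply: le_measure; rewrite ?inE//.
    by apply: measurableD; exact: sample_history_measurable (hist _).
  by move=> t [h _] j jk [gj _]; exact: (h j jk).
rewrite -(fineK (fin_num_measure Q _ mr)) lee_fin; apply: le_trans rle _.
exact: bin_cdf_tail.
Qed.

End progress.

(** * The theorem *)

Theorem theorem3p1 (R : realType) (n : nat)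
    (dO : measure_display) (Omega : measurableType dO)
    (P : probability Omega R)
    (f : Omega -> 'rV[R]_n -> R) (g : Omega -> 'rV[R]_n -> 'rV[R]_n)
    (f_convex : forall w, convex_function setT (f w))
    (f_meas : forall x, measurable_fun setT (fun w => f w x))
    (g_subgrad : forall w x, subdifferential (f w) x (g w x))
    (feasible_nonempty : feasible_set f !=set0)
    (x0 z0 : 'rV[R]_n) (z0_closest : is_closest x0 (feasible_set f) z0)
    (M : R)
    (f_lipschitz : forall w, exists U : set 'rV[R]_n,
       [/\ open U, eball z0 (enorm (x0 - z0)) `<=` U
         & elipschitz_on M U (f w)])
    (mu a Delta : R) (mu_gt0 : 0 < mu) (a_ge1 : 1 <= a)
    (Delta_gt0 : 0 < Delta) (Delta_le1 : Delta <= 1)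
    (growth : growth_assumption P f (eball z0 (enorm (x0 - z0))) mu a Delta)
    (eps : R) (eps_gt0 : 0 < eps)
    (eps_lt : eps < M * edistance x0 (feasible_set f))
    (Gamma : R) (Gamma_gt0 : 0 < Gamma) (Gamma_lt : Gamma < Delta)
    (L : nat) (L_ge1 : (1 <= L)%N)
    (sel : 'rV[R]_n -> ('I_L -> Omega) -> 'I_L) (sel_argmax : argmax_rule f sel)
    (dT : measure_display) (T : measurableType dT) (Q : probability T R)
    (W : nat -> 'I_L -> {RV Q >-> Omega}) (W_iid : iid_samples P W) :
  let p := batch_prob Gamma L in
  let E' := iteration_bound M mu a eps p (edistance x0 (feasible_set f)) in
  let x (k : nat) (t : T) := polyakFM f g sel x0 (fun j l => W j l t) k in
  let good := [set y : 'rV[R]_n |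
    ((1 - Gamma)%R%:E <= P (near_satisfied f y eps))%E] in
  let close := [set y : 'rV[R]_n |
    edistance y (feasible_set f) <= (eps / mu) `^ (1 / a)] in
  measurable_iterates W x ->
  (\int[Q]_t first_time R (good `&` close) (x ^~ t) <= E'%:E)%E /\
  forall k : nat, 2 * E' <= k%:R ->
    (Q [set t | is_first good (x ^~ t) k] <=
     (1 / 2 * (1 / (1 + 1 / 2 * (p / (1 - p))))
                ^ (k%:Z - Num.ceil (2 * E')))%R%:E)%E.
Proof.
move=> p E' x good close x_meas.
have D_ge0 : 0 <= edistance x0 (feasible_set f) by exact: edistance_ge0.
have M_gt0 : 0 < M.
  rewrite ltNge; apply/negP => M_le0.
  by have := lt_trans eps_gt0 eps_lt; rewrite ltNge mulr_le0_ge0.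
have [z0_feasible _] := z0_closest.
have Gamma_lt1 : Gamma < 1 by exact: lt_le_trans Delta_le1.
split.
  exact: (expected_first_time_le f_meas g_subgrad feasible_nonempty f_lipschitz
    M_gt0 mu_gt0 a_ge1 growth eps_gt0 Gamma_gt0 Gamma_lt sel_argmax W_iid x_meas
    z0_feasible Gamma_lt1 L_ge1 eps_lt).
move=> k; exact: (first_good_le f_meas g_subgrad feasible_nonempty f_lipschitz
  M_gt0 mu_gt0 a_ge1 growth eps_gt0 Gamma_gt0 Gamma_lt sel_argmax W_iid x_meas
  z0_feasible Gamma_lt1 L_ge1 eps_lt).
Qed.
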